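(* Let $D$ be a solid digraph. Then the map $\hat\Phi\colon|D|\to\varprojlim(D/P)_{P\in\mathcal{P}(D)}$, $x\mapsto(\hat\varphi_P(x))_{P\in\mathcal{P}(D)}$, is a homeomorphism.
   Context: Digraphs have no loops and no parallel edges. $\mathcal{X}(D)$: finite subsets of $V(D)$. $D$ is solid if $D-X$ has only finitely many strong components for every $X\in\mathcal{X}(D)$. A vertex set $Y$ separates vertex sets $A,B$ if every $A$–$B$ path meets $Y$ or every $B$–$A$ path meets $Y$. A finite partition $P$ of $V(D)$ is admissible if any two distinct classes are separated by a finite vertex set; $\mathcal{P}(D)$ is the set of admissible partitions, directed by $P\le P'$ iff $P'$ refines $P$. $D/P$ is the finite multi-digraph on $P$ where for distinct $p_1,p_2\in P$ there is one edge $(e,p_1,p_2)$ per edge $e$ of $D$ from $p_1$ to $p_2$ if there are finitely many, and a single quotient edge $(p_1p_2,p_1,p_2)$ if there are infinitely many; it carries the 1-complex topology. For $P\le P'$, $f_{P'P}\colon D/P'\to D/P$ sends $p'$ to the class $p\supseteq p'$; an edge $(e',p_1',p_2')$ with both ends in one class $p$ goes to $p$; otherwise, with $p_1'\subseteq p_1\ne p_2\supseteq p_2'$, it is mapped pointwise onto the quotient edge from $p_1$ to $p_2$ if it exists, else onto $(e',p_1,p_2)$. $\varprojlim(D/P)_{P}$ is the subspace of $\prod_P D/P$ of all $(x_P)$ with $f_{P'P}(x_{P'})=x_P$ whenever $P\le P'$. Ends and limit edges: rays are one-way infinite directed paths, tails are subrays; a ray is solid if for each $X\in\mathcal{X}(D)$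 it has a tail in a strong component of $D-X$; solid rays are equivalent if for each $X$ they have tails in the same strong component; classes are ends, $\Omega(D)$. $C(X,\omega)$: the strong component of $D-X$ containing tails of rays of $\omega$ ($\omega$ lives in it); $X$ separates ends $\omega,\eta$ if $C(X,\omega)\ne C(X,\eta)$. For distinct ends, $(\omega,\eta)$ is a limit edge if for each $X$ separating them $D$ has an edge from $C(X,\omega)$ to $C(X,\eta)$; for a vertex $v$, $(v,\omega)$ (resp. $(\omega,v)$) is a limit edge if $D$ has an edge from $v$ to $C(X,\omega)$ (resp. from $C(X,\omega)$ to $v$) for all $X$ with $v\notin C(X,\omega)$. $\Lambda(D)$: limit edges. $|D|$: from $V(D)\cup\Omega(D)$ and copies $[0,1]_e$, $e\in E(D)\cup\Lambda(D)$, identify the tail of $e$ with $0$ and head with $1$; points on different edges correspond if they come from the same real. A limit edge lives in a strong component $C$ of $D-X$ if each endpoint is a vertex of or an end living in $C$. Topology generated by: (1) open $\varepsilon$-stars around vertices; (2) open subintervals of interiors of edges of $D$; (3) for an end $\omega$ and $X\in\mathcal{X}(D)$, $\hat C_\varepsilon(X,\omega)$: vertices and inner points of edges of $C(X,\omega)$, ends living in $C(X,\omega)$, points of limit edges living in $C(X,\omega)$, and for each edge of $E(D)\cup\Lambda(D)$ with exactly one endpoint $y$ a vertex of/end living in $C(X,\omega)$, the half-open segment of length $\varepsilon$ at $y$; (4) for an inner point $z$ of a limit edge $(\omega,\eta)$ and $X$ separating $\omega,\eta$: union of open $\varepsilon$-intervals around points corresponding to $z$ on all edges of $D$ from $C(X,\omega)$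 to $C(X,\eta)$ and on limit edges with tail a vertex of/end living in $C(X,\omega)$ and head a vertex of/end living in $C(X,\eta)$; for $(v,\omega)$ with $v\in X$ analogously over edges of $D$ from $v$ to $C(X,\omega)$ and limit edges $(v,\omega')$, $\omega'$ living in $C(X,\omega)$; symmetrically for $(\omega,v)$. $\hat\varphi_P\colon|D|\to D/P$: a vertex goes to its class; an inner point of an edge $vw$ of $D$ goes to the class of $v$ if $v,w$ are in one class, else to the corresponding point of the edge of $D/P$ from the class of $v$ to that of $w$ (the copy of $vw$ or the quotient edge); an end $\omega$ goes to the class containing tails of all rays of $\omega$; an inner point of a limit edge $\lambda$ goes to the common image of its endpoints if these coincide, and otherwise to the corresponding point of the quotient edge of $D/P$ between the images of the endpoints in the direction of $\lambda$ (which exists). *)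

(* Defs.v *)
From Stdlib Require Import Reals List Classical ClassicalEpsilon.
Open Scope R_scope.
Set Implicit Arguments.

Definition fin_set {T : Type} (S : T -> Prop) : Prop :=
  exists l : list T, forall x, S x -> In x l.

Definition generated {T : Type} (S : T -> Prop) (B : (T -> Prop) -> Prop)
  (U : T -> Prop) : Prop :=
  (forall x, U x -> S x) /\
  forall x, U x -> exists l : list (T -> Prop),
    (forall b, In b l -> B b) /\ S x /\ (forall b, In b l -> b x) /\
    forall y, S y -> (forall b, In b l -> b y) -> U y.

Definition homeo {T1 T2 : Type} (S1 : T1 -> Prop) (O1 : (T1 -> Prop) -> Prop)
  (S2 : T2 -> Prop) (O2 : (T2 -> Prop) -> Prop) (f : T1 -> T2) : Prop :=
  (forall x, S1 x -> S2 (f x)) /\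
  exists g : T2 -> T1,
    (forall y, S2 y -> S1 (g y)) /\
    (forall x, S1 x -> g (f x) = x) /\
    (forall y, S2 y -> f (g y) = y) /\
    (forall U, O2 U -> O1 (fun x => S1 x /\ U (f x))) /\
    (forall U, O1 U -> O2 (fun y => S2 y /\ U (g y))).

Section Digraph.
Variable V : Type.
(* the edge relation of the digraph D: an edge is an ordered pair (u,w) with E u w
   (hence no parallel edges); loops are excluded by a hypothesis of the theorem *)
Variable E : V -> V -> Prop.

Definition walk_in (X : V -> Prop) (u v : V) : Prop :=
  exists (n : nat) (w : nat -> V), w 0%nat = u /\ w n = v /\
    (forall i, (i <= n)%nat -> ~ X (w i)) /\
    (forall i, (i < n)%nat -> E (w i) (w (S i))).

Definition scomp (X : V -> Prop) (u : V) : V -> Prop :=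
  fun v => ~ X u /\ walk_in X u v /\ walk_in X v u.

Definition is_scomp (X : V -> Prop) (C : V -> Prop) : Prop :=
  exists u, ~ X u /\ C = scomp X u.

Definition solid : Prop := forall X, fin_set X -> fin_set (is_scomp X).

Definition ray (r : nat -> V) : Prop :=
  (forall m n, r m = r n -> m = n) /\ forall n, E (r n) (r (S n)).

Definition tail_in (r : nat -> V) (C : V -> Prop) : Prop :=
  exists n, forall m, (n <= m)%nat -> C (r m).

Definition solid_ray (r : nat -> V) : Prop :=
  ray r /\ forall X, fin_set X -> exists u, ~ X u /\ tail_in r (scomp X u).

Definition ray_equiv (r1 r2 : nat -> V) : Prop :=
  forall X, fin_set X -> exists u, ~ X u /\ tail_in r1 (scomp X u) /\ tail_in r2 (scomp X u).

Definition is_end (Om : (nat -> V) -> Prop) : Prop :=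
  exists r, solid_ray r /\ forall r', Om r' <-> (solid_ray r' /\ ray_equiv r r').

Definition same_end (Om Eta : (nat -> V) -> Prop) : Prop := forall r, Om r <-> Eta r.

Definition CX (X : V -> Prop) (Om : (nat -> V) -> Prop) : V -> Prop :=
  fun v => exists r, Om r /\ exists n, forall m, (n <= m)%nat -> scomp X (r m) v.

Definition lives (Eta : (nat -> V) -> Prop) (C : V -> Prop) : Prop :=
  exists r, Eta r /\ tail_in r C.

Definition sepE (X : V -> Prop) (Om Eta : (nat -> V) -> Prop) : Prop :=
  ~ (forall v, CX X Om v <-> CX X Eta v).

Definition node : Type := (V + ((nat -> V) -> Prop))%type.

Definition inComp (C : V -> Prop) (n : node) : Prop :=
  match n with inl v => C v | inr Eta => lives Eta C end.

Definition limedge (a b : node) : Prop :=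
  match a, b with
  | inr Om, inr Eta => is_end Om /\ is_end Eta /\ ~ same_end Om Eta /\
      forall X, fin_set X -> sepE X Om Eta ->
        exists u w, E u w /\ CX X Om u /\ CX X Eta w
  | inl v, inr Om => is_end Om /\
      forall X, fin_set X -> ~ CX X Om v -> exists u, E v u /\ CX X Om u
  | inr Om, inl v => is_end Om /\
      forall X, fin_set X -> ~ CX X Om v -> exists u, E u v /\ CX X Om u
  | inl _, inl _ => False
  end.

Definition arc (a b : node) : Prop :=
  (exists u w, a = inl u /\ b = inl w /\ E u w) \/ limedge a b.

(* DI a b t : the point with parameter t on the edge/limit edge from a to b *)
Inductive dpt : Type :=
| DV (v : V)
| DE (Om : (nat -> V) -> Prop)
| DI (a b : node) (t : R).

Definition carrierD (x : dpt) : Prop :=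
  match x with
  | DV _ => True
  | DE Om => is_end Om
  | DI a b t => arc a b /\ 0 < t < 1
  end.

Definition star (v : V) (eps : R) : dpt -> Prop := fun x =>
  x = DV v \/
  (exists b t, x = DI (inl v) b t /\ arc (inl v) b /\ 0 < t < eps) \/
  (exists a t, x = DI a (inl v) t /\ arc a (inl v) /\ 1 - eps < t < 1).

Definition edge_int (u w : V) (s1 s2 : R) : dpt -> Prop := fun x =>
  exists t, x = DI (inl u) (inl w) t /\ s1 < t < s2.

Definition Chat (X : V -> Prop) (Om : (nat -> V) -> Prop) (eps : R) : dpt -> Prop :=
  fun x => match x with
  | DV v => CX X Om v
  | DE Eta => is_end Eta /\ lives Eta (CX X Om)
  | DI a b t => arc a b /\
      ((inComp (CX X Om) a /\ inComp (CX X Om) b) \/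
       (inComp (CX X Om) a /\ ~ inComp (CX X Om) b /\ t < eps) \/
       (~ inComp (CX X Om) a /\ inComp (CX X Om) b /\ 1 - eps < t))
  end.

Definition lim_nbhs_ee (X : V -> Prop) (Om Eta : (nat -> V) -> Prop) (z eps : R) :
  dpt -> Prop := fun x =>
  exists a b t, x = DI a b t /\ arc a b /\ inComp (CX X Om) a /\
    inComp (CX X Eta) b /\ Rabs (t - z) < eps.

Definition lim_nbhs_ve (v : V) (X : V -> Prop) (Om : (nat -> V) -> Prop) (z eps : R) :
  dpt -> Prop := fun x =>
  exists b t, x = DI (inl v) b t /\ arc (inl v) b /\ inComp (CX X Om) b /\
    Rabs (t - z) < eps.

Definition lim_nbhs_ev (v : V) (X : V -> Prop) (Om : (nat -> V) -> Prop) (z eps : R) :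
  dpt -> Prop := fun x =>
  exists a t, x = DI a (inl v) t /\ arc a (inl v) /\ inComp (CX X Om) a /\
    Rabs (t - z) < eps.

Definition subbaseD (U : dpt -> Prop) : Prop :=
  (exists v eps, 0 < eps < 1 /\ U = star v eps) \/
  (exists u w s1 s2, E u w /\ 0 <= s1 /\ s1 < s2 /\ s2 <= 1 /\ U = edge_int u w s1 s2) \/
  (exists X Om eps, fin_set X /\ is_end Om /\ 0 < eps < 1 /\ U = Chat X Om eps) \/
  (exists Om Eta z X eps, limedge (inr Om) (inr Eta) /\ 0 < z < 1 /\ fin_set X /\
     sepE X Om Eta /\ 0 < eps /\ U = lim_nbhs_ee X Om Eta z eps) \/
  (exists v Om z X eps, limedge (inl v) (inr Om) /\ 0 < z < 1 /\ fin_set X /\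
     X v /\ 0 < eps /\ U = lim_nbhs_ve v X Om z eps) \/
  (exists v Om z X eps, limedge (inr Om) (inl v) /\ 0 < z < 1 /\ fin_set X /\
     X v /\ 0 < eps /\ U = lim_nbhs_ev v X Om z eps).

Definition openD : (dpt -> Prop) -> Prop := generated carrierD subbaseD.

Definition is_path (n : nat) (p : nat -> V) : Prop :=
  (forall i, (i < n)%nat -> E (p i) (p (S i))) /\
  (forall i j, (i <= n)%nat -> (j <= n)%nat -> p i = p j -> i = j).

Definition all_paths_meet (Y A B : V -> Prop) : Prop :=
  forall n p, is_path n p -> A (p 0%nat) -> B (p n) -> exists i, (i <= n)%nat /\ Y (p i).

Definition separates (Y A B : V -> Prop) : Prop :=
  all_paths_meet Y A B \/ all_paths_meet Y B A.

Definition admissible (P : (V -> Prop) -> Prop) : Prop :=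
  fin_set P /\
  (forall p, P p -> exists v, p v) /\
  (forall v, exists p, P p /\ p v) /\
  (forall p q v, P p -> P q -> p v -> q v -> p = q) /\
  (forall p q, P p -> P q -> p <> q -> exists Y, fin_set Y /\ separates Y p q).

Definition Part : Type := {P : (V -> Prop) -> Prop | admissible P}.

(* P' refines P, i.e. P <= P' *)
Definition refines (P P' : (V -> Prop) -> Prop) : Prop :=
  forall p', P' p' -> exists p, P p /\ forall v, p' v -> p v.

(* QE l p1 p2 t : point with parameter t on the edge of D/P from p1 to p2 with
   label l; l = Some (u,w) for the copy of the edge uw of D, l = None for the
   quotient edge p1p2 *)
Inductive qpt : Type :=
| QN (p : V -> Prop)
| QE (l : option (V * V)) (p1 p2 : V -> Prop) (t : R).

Definition inf_edges (p1 p2 : V -> Prop) : Prop :=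
  ~ fin_set (fun e : V * V => E (fst e) (snd e) /\ p1 (fst e) /\ p2 (snd e)).

Definition qedge (P : (V -> Prop) -> Prop) (l : option (V * V)) (p1 p2 : V -> Prop) : Prop :=
  P p1 /\ P p2 /\ p1 <> p2 /\
  match l with
  | Some (u, w) => E u w /\ p1 u /\ p2 w /\ ~ inf_edges p1 p2
  | None => inf_edges p1 p2
  end.

Definition carrierQ (P : (V -> Prop) -> Prop) (x : qpt) : Prop :=
  match x with
  | QN p => P p
  | QE l p1 p2 t => qedge P l p1 p2 /\ 0 < t < 1
  end.

Definition ept (l : option (V * V)) (p1 p2 : V -> Prop) (t : R) : qpt :=
  if Req_EM_T t 0 then QN p1 else if Req_EM_T t 1 then QN p2 else QE l p1 p2 t.

Definition cx_open (P : (V -> Prop) -> Prop) (U : qpt -> Prop) : Prop :=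
  (forall x, U x -> carrierQ P x) /\
  forall l p1 p2, qedge P l p1 p2 -> forall t, 0 <= t <= 1 -> U (ept l p1 p2 t) ->
    exists d, 0 < d /\ forall s, 0 <= s <= 1 -> Rabs (s - t) < d -> U (ept l p1 p2 s).

(* the bonding map f_{P'P}; only the classes of P are needed *)
Definition cover (P : (V -> Prop) -> Prop) (p' : V -> Prop) : V -> Prop :=
  fun w => exists p, P p /\ (exists u, p' u /\ p u) /\ p w.

Definition fmap (P : (V -> Prop) -> Prop) (x' : qpt) : qpt :=
  match x' with
  | QN p' => QN (cover P p')
  | QE l p1' p2' t =>
      let p1 := cover P p1' in let p2 := cover P p2' in
      if excluded_middle_informative (p1 = p2) then QN p1
      else QE (if excluded_middle_informative (inf_edges p1 p2) then None else l) p1 p2 t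
  end.

Definition LimS (x : Part -> qpt) : Prop :=
  (forall P : Part, carrierQ (proj1_sig P) (x P)) /\
  forall P P' : Part, refines (proj1_sig P) (proj1_sig P') ->
    fmap (proj1_sig P) (x P') = x P.

Definition subbaseL (U : (Part -> qpt) -> Prop) : Prop :=
  exists (P : Part) (W : qpt -> Prop), cx_open (proj1_sig P) W /\ U = (fun x => W (x P)).

Definition openL : ((Part -> qpt) -> Prop) -> Prop := generated LimS subbaseL.

Definition cls (P : (V -> Prop) -> Prop) (v : V) : V -> Prop :=
  fun w => exists p, P p /\ p v /\ p w.

Definition clsE (P : (V -> Prop) -> Prop) (Om : (nat -> V) -> Prop) : V -> Prop :=
  fun w => exists p, P p /\ p w /\ forall r, Om r -> tail_in r p.

Definition nodeimg (P : (V -> Prop) -> Prop) (n : node) : V -> Prop :=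
  match n with inl v => cls P v | inr Om => clsE P Om end.

Definition phi (P : (V -> Prop) -> Prop) (x : dpt) : qpt :=
  match x with
  | DV v => QN (cls P v)
  | DE Om => QN (clsE P Om)
  | DI a b t =>
      let qa := nodeimg P a in let qb := nodeimg P b in
      if excluded_middle_informative (qa = qb) then QN qa else
      match a, b with
      | inl u, inl w =>
          QE (if excluded_middle_informative (inf_edges qa qb) then None else Some (u, w)) qa qb t
      | _, _ => QE None qa qb t
      end
  end.

Definition Phi (x : dpt) : Part -> qpt := fun P => phi (proj1_sig P) x.

End Digraph.

(* Main.v *)
Require Import Defs.
From Stdlib Require Import Reals List Classical ClassicalEpsilon
  FunctionalExtensionality PropExtensionality Arith Lia Lra.
Import ListNotations.
Set Implicit Arguments.
Unset Strict Implicit.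

(* For a finite vertex set X let P_X consist of the singletons in X and the strong components of
   D - X. As D is solid, P_X is an admissible partition, and each admissible P is refined by some
   P_X: take for X the union of separators of the pairs of classes. So only the P_X matter. For
   them the images under phi of the nodes of |D| are {v} and C(X, omega), and every subbasic open
   set of |D| is the preimage of an open set of some D/P_X, which makes the inverse of Phi
   continuous; Phi itself is continuous as D/P has finitely many edges.

   A point of the limit has a consistent family of tail classes and one of head classes. Such a
   family comes from a vertex or is a direction, that is, a monotone choice f of a strong component
   f(X) of each D - X, and every direction comes from an end. To see the latter, call a finite
   set A dominating if f(Z) meets A for each finite Z disjoint from A. Either each finite set
   is disjoint from some dominating set, and a locally finite walk that visits infinitely many
   disjoint dominating sets has a tail in every f(X); or there is a finite U such that no finite
   set disjoint from U is dominating, and then there is a sequence X_0, X_1, ... for which the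
   f(X_n) have empty intersection, and a walk passing from each f(X_n) to f(X_{n+1}) will do. *)

(** * Finite sets and walks *)

Section FiniteSets.
Context {T : Type}.
Implicit Types (X Y S : T -> Prop).

Lemma set_ext X Y : (forall v, X v <-> Y v) -> X = Y.
Proof.
  intro H. apply functional_extensionality. intro v.
  now apply propositional_extensionality.
Qed.

Lemma fin_list (l : list T) : fin_set (fun v => In v l).
Proof. now exists l. Qed.

Lemma fin_union X Y : fin_set X -> fin_set Y -> fin_set (fun v => X v \/ Y v).
Proof.
  intros [l Hl] [m Hm]. exists (l ++ m). intros v [H|H]; apply in_or_app; auto.
Qed.

Lemma fin_sub X Y : fin_set Y -> (forall v, X v -> Y v) -> fin_set X.
Proof. intros [l Hl] H. exists l. auto. Qed.

Lemma fin_add X (u : T) : fin_set X -> fin_set (fun v => X v \/ v = u).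
Proof.
  intro H. apply fin_union; [exact H|]. exists [u]. intros v ->. now left.
Qed.

End FiniteSets.

Section Uniformity.
Context {T : Type}.
Implicit Types S : T -> Prop.

(** As [Q s] passes to larger sets, the union of the witnesses over the elements of [S] serves all
    of them. *)
Lemma fin_unif {U : Type} S (Q : T -> (U -> Prop) -> Prop) :
  fin_set S ->
  (forall s (A A' : U -> Prop), S s -> Q s A -> (forall v, A v -> A' v) -> Q s A') ->
  (forall s, S s -> exists A, fin_set A /\ Q s A) ->
  exists A, fin_set A /\ forall s, S s -> Q s A.
Proof.
  intros [l Hl] Hm HS.
  assert (H : exists A, fin_set A /\ forall s, In s l -> S s -> Q s A).
  { clear Hl. induction l as [|a l [X [HX IH]]].
    - exists (fun _ => False). split; [exists []; tauto | intros s []].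
    - destruct (classic (S a)) as [Ha|Ha].
      + destruct (HS a Ha) as [Y [HY HQ]].
        exists (fun v => X v \/ Y v). split; [now apply fin_union|].
        intros s [<-|Hs] HSs.
        * apply Hm with Y; auto.
        * apply Hm with X; auto.
      + exists X. split; [exact HX|]. intros s [<-|Hs] HSs; [tauto|auto]. }
  destruct H as [X [HX H]]. exists X. auto.
Qed.

(** A minimum of finitely many radii. It starts from 1/2, so that the result is below 1 as required
    of the radii of stars. *)
Lemma fin_unif_eps S (Q : T -> R -> Prop) :
  fin_set S ->
  (forall s d d', S s -> Q s d -> 0 < d' <= d -> Q s d') ->
  (forall s, S s -> exists d, 0 < d /\ Q s d) ->
  exists d, 0 < d < 1 /\ forall s, S s -> Q s d.
Proof.
  intros [l Hl] Hm HS.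
  assert (H : exists d, 0 < d < 1 /\ forall s, In s l -> S s -> Q s d).
  { clear Hl. induction l as [|a l [d [Hd IH]]].
    - exists (1/2). split; [lra | intros s []].
    - destruct (classic (S a)) as [Ha|Ha].
      + destruct (HS a Ha) as [e [He HQ]].
        assert (Hmin : 0 < Rmin d e) by (apply Rmin_glb_lt; lra).
        pose proof (Rmin_l d e). pose proof (Rmin_r d e).
        exists (Rmin d e). split; [lra|].
        intros s [<-|Hs] HSs.
        * apply Hm with e; auto.
        * apply Hm with d; auto; lra.
      + exists d. split; [exact Hd|]. intros s [<-|Hs] HSs; [tauto|auto]. }
  destruct H as [d [Hd H]]. exists d. auto.
Qed.

Lemma fin_unif_nat S (Q : T -> nat -> Prop) :
  fin_set S ->
  (forall s n m, S s -> Q s n -> (n <= m)%nat -> Q s m) ->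
  (forall s, S s -> exists n, Q s n) ->
  exists n, forall s, S s -> Q s n.
Proof.
  intros [l Hl] Hm HS.
  assert (H : exists n, forall s, In s l -> S s -> Q s n).
  { clear Hl. induction l as [|a l [n IH]].
    - exists O. intros s [].
    - destruct (classic (S a)) as [Ha|Ha].
      + destruct (HS a Ha) as [m HQ].
        exists (n + m)%nat. intros s [<-|Hs] HSs.
        * apply Hm with m; auto; lia.
        * apply Hm with n; auto; lia.
      + exists n. intros s [<-|Hs] HSs; [tauto|auto]. }
  destruct H as [n H]. exists n. auto.
Qed.

Lemma dependent_choice (I : T -> Prop) (Q : T -> T -> Prop) (s0 : T) :
  I s0 -> (forall s, I s -> exists s', I s' /\ Q s s') ->
  exists s : nat -> T, s O = s0 /\ forall n, I (s n) /\ Q (s n) (s (S n)).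
Proof.
  intros H0 Hs.
  (* The invariant travels in a subset type, so that the chosen successor map can be iterated. *)
  pose (next := fun s : {s | I s} =>
    let (s', H) := constructive_indefinite_description _ (Hs (proj1_sig s) (proj2_sig s))
    in exist I s' (proj1 H)).
  assert (Hn : forall s, Q (proj1_sig s) (proj1_sig (next s))).
  { intro s. unfold next. destruct constructive_indefinite_description as [s' H].
    exact (proj2 H). }
  pose (f := fun n => Nat.iter n next (exist I s0 H0)).
  exists (fun n => proj1_sig (f n)). split; [reflexivity|].
  intro n. split; [exact (proj2_sig (f n))|]. apply (Hn (f n)).
Qed.

End Uniformity.

(** * Walks, paths and strong components *)

Section Walks.
Context {V : Type} (E : V -> V -> Prop).
Implicit Types (X Y C : V -> Prop) (u v w : V).

(** The list leaves out the start [u]: the empty list is then the trivial walk at [u], and joining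
    walks is [++]. *)
Fixpoint list_walk (u : V) (l : list V) : Prop :=
  match l with
  | [] => True
  | a :: l' => E u a /\ list_walk a l'
  end.

Lemma last_cons (l : list V) a u : last (a :: l) u = last l a.
Proof.
  revert a u. induction l as [|b l IH]; intros a u; [reflexivity|].
  change (last (a :: b :: l) u) with (last (b :: l) u).
  rewrite !IH. reflexivity.
Qed.

Lemma last_app (l m : list V) u : last (l ++ m) u = last m (last l u).
Proof.
  revert u. induction l as [|a l IH]; intro u; [reflexivity|].
  simpl app. rewrite !last_cons. apply IH.
Qed.

Lemma last_in (l : list V) u : In (last l u) (u :: l).
Proof.
  revert u. induction l as [|a l IH]; intro u; [now left|].
  rewrite last_cons. right. apply IH.
Qed.

Lemma nth_length_last (l : list V) u d : nth (length l) (u :: l) d = last l u.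
Proof.
  revert u. induction l as [|a l IH]; intro u; [reflexivity|].
  rewrite last_cons. exact (IH a).
Qed.

Lemma list_walk_app u l m :
  list_walk u (l ++ m) <-> list_walk u l /\ list_walk (last l u) m.
Proof.
  revert u. induction l as [|a l IH]; intro u; simpl app; [simpl; tauto|].
  rewrite last_cons. simpl. rewrite IH. tauto.
Qed.

Lemma list_walk_nth u l i :
  list_walk u l -> (i < length l)%nat -> E (nth i (u :: l) u) (nth (S i) (u :: l) u).
Proof.
  assert (H : forall l u d i, list_walk u l -> (i < length l)%nat ->
    E (nth i (u :: l) d) (nth (S i) (u :: l) d)).
  { clear. induction l as [|a l IH]; intros u d i Hw Hi; simpl in Hi; [lia|].
    destruct Hw as [Ha Hw]. destruct i as [|i]; [exact Ha|].
    apply (IH a d i Hw). lia. }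
  apply H.
Qed.

Lemma walk_in_list X u v :
  walk_in E X u v <->
  ~ X u /\ exists l, list_walk u l /\ last l u = v /\ forall a, In a l -> ~ X a.
Proof.
  split.
  - intros [n [w [H0 [Hn [HX HE]]]]]. split; [subst u; apply HX; lia|].
    revert u v w H0 Hn HX HE. induction n as [|n IH]; intros u v w H0 Hn HX HE.
    + exists []. simpl. subst. auto.
    + destruct (IH (w 1%nat) v (fun i => w (S i))) as [l [Hl [Hv Ha]]]; auto.
      * intros i Hi. apply HX. lia.
      * intros i Hi. apply HE. lia.
      * exists (w 1%nat :: l). rewrite last_cons. simpl. repeat split; auto.
        -- subst u. apply HE. lia.
        -- intros a [<-|Hal]; [apply HX; lia|auto].
  - intros [Hu [l [Hl [Hv Ha]]]].
    exists (length l), (fun i => nth i (u :: l) u). repeat split.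
    + subst v. apply nth_length_last.
    + intros i Hi. destruct (nth_in_or_default i (u :: l) u) as [[<-|H]|H].
      * exact Hu.
      * now apply Ha.
      * now rewrite H.
    + intros i Hi. now apply list_walk_nth.
Qed.

Lemma walk_in_refl X u : ~ X u -> walk_in E X u u.
Proof. intro H. apply walk_in_list. split; [exact H|]. exists []. simpl. tauto. Qed.

Lemma walk_in_trans X u v w : walk_in E X u v -> walk_in E X v w -> walk_in E X u w.
Proof.
  rewrite !walk_in_list. intros [Hu [l [Hl [Hv Ha]]]] [_ [m [Hm [Hw Hb]]]].
  split; [exact Hu|]. exists (l ++ m). rewrite list_walk_app, last_app, Hv.
  repeat split; auto. intros a H. apply in_app_or in H. destruct H; auto.
Qed.

Lemma walk_in_mono X Y u v :
  (forall a, X a -> Y a) -> walk_in E Y u v -> walk_in E X u v.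
Proof.
  intros H [n [w [H0 [Hn [HX HE]]]]]. exists n, w. repeat split; auto.
  intros i Hi Hc. exact (HX i Hi (H _ Hc)).
Qed.

Lemma walk_in_end X u v : walk_in E X u v -> ~ X v.
Proof. intros [n [w [H0 [Hn [HX HE]]]]]. subst v. apply HX. lia. Qed.

(* If [w i = w j] with [i < j], the part of the walk between them can be cut out. *)
Lemma walk_in_path X u v : walk_in E X u v ->
  exists n p, is_path E n p /\ p O = u /\ p n = v /\ forall i, (i <= n)%nat -> ~ X (p i).
Proof.
  intros [n H]. revert H. induction n as [n IH] using lt_wf_ind.
  intros [w [H0 [Hn [HX HE]]]].
  destruct (classic (forall i j, (i <= n)%nat -> (j <= n)%nat -> w i = w j -> i = j))
    as [Hinj|Hninj].
  { exists n, w. repeat split; auto. }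
  assert (Hij : exists i j, (i < j)%nat /\ (j <= n)%nat /\ w i = w j).
  { apply NNPP. intro Hc. apply Hninj. intros i j Hi Hj Heq.
    destruct (lt_eq_lt_dec i j) as [[Hlt|He]|Hlt]; [|exact He|].
    - exfalso. apply Hc. exists i, j. auto.
    - exfalso. apply Hc. exists j, i. auto. }
  destruct Hij as [i [j [Hij [Hj Heq]]]].
  apply (IH (n - (j - i))%nat); [lia|].
  exists (fun k => if Nat.leb k i then w k else w (k + (j - i))%nat).
  (* At [k = i] the two branches agree because [w i = w j]; so the step across the cut is still an
     edge of the walk. *)
  assert (Hk : forall k, (i <= k)%nat ->
    (if Nat.leb k i then w k else w (k + (j - i))%nat) = w (k + (j - i))%nat).
  { intros k Hk. destruct (Nat.leb_spec k i); [|reflexivity].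
    replace k with i by lia. replace (i + (j - i))%nat with j by lia. exact Heq. }
  repeat split.
  - exact H0.
  - rewrite Hk by lia. replace (n - (j - i) + (j - i))%nat with n by lia. exact Hn.
  - intros k Hkn. destruct (Nat.leb_spec k i); apply HX; lia.
  - intros k Hkn. destruct (Nat.leb_spec i k).
    + rewrite !Hk by lia. apply HE. lia.
    + destruct (Nat.leb_spec k i); [|lia]. destruct (Nat.leb_spec (S k) i); [|lia].
      apply HE. lia.
Qed.

Lemma path_walk_in X n (p : nat -> V) : is_path E n p ->
  (forall i, (i <= n)%nat -> ~ X (p i)) -> walk_in E X (p O) (p n).
Proof. intros [HE _] H. exists n, p. auto. Qed.

Lemma scomp_refl X u : ~ X u -> scomp E X u u.
Proof. intro H. repeat split; auto using walk_in_refl. Qed.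

Lemma scomp_notin X u v : scomp E X u v -> ~ X v.
Proof. intros [_ [H _]]. exact (walk_in_end H). Qed.

Lemma scomp_sym X u v : scomp E X u v -> scomp E X v u.
Proof. intros [H [H1 H2]]. split; [exact (walk_in_end H1)|auto]. Qed.

Lemma scomp_trans X u v w : scomp E X u v -> scomp E X v w -> scomp E X u w.
Proof.
  intros [H [H1 H2]] [_ [H3 H4]]. repeat split; auto; eapply walk_in_trans; eauto.
Qed.

Lemma scomp_eq X u v : scomp E X u v -> scomp E X u = scomp E X v.
Proof.
  intro H. apply set_ext. intro w. split; intro Hw.
  - exact (scomp_trans (scomp_sym H) Hw).
  - exact (scomp_trans H Hw).
Qed.

Lemma scomp_mono X Y u v : (forall a, X a -> Y a) -> scomp E Y u v -> scomp E X u v.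
Proof.
  intros H [Hu [H1 H2]]. repeat split; auto; eapply walk_in_mono; eauto.
Qed.

Lemma is_scomp_eq X C v : is_scomp E X C -> C v -> C = scomp E X v.
Proof. intros [u [Hu ->]] H. now apply scomp_eq. Qed.

Lemma is_scomp_nonempty X C : is_scomp E X C -> exists v, C v.
Proof. intros [u [Hu ->]]. exists u. now apply scomp_refl. Qed.

Lemma is_scomp_notin X C v : is_scomp E X C -> C v -> ~ X v.
Proof. intros [u [Hu ->]] H. exact (scomp_notin H). Qed.

Lemma scomp_between X u a v : scomp E X u v ->
  walk_in E X u a -> walk_in E X a v -> scomp E X u a.
Proof.
  intros [Hu [H1 H2]] H3 H4. repeat split; auto. exact (walk_in_trans H4 H2).
Qed.

Lemma list_walk_split X u l a : ~ X u -> list_walk u l -> (forall b, In b l -> ~ X b) ->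
  In a l -> walk_in E X u a /\ walk_in E X a (last l u).
Proof.
  intros Hu Hl HX Ha. destruct (in_split a l Ha) as [l1 [l2 ->]].
  change (a :: l2) with ([a] ++ l2) in *. rewrite app_assoc in Hl |- *.
  apply list_walk_app in Hl. destruct Hl as [Hl1 Hl2].
  rewrite last_app in Hl2 |- *. simpl in Hl2 |- *.
  rewrite last_app. simpl.
  split; apply walk_in_list.
  - split; [exact Hu|]. exists (l1 ++ [a]). rewrite last_app. repeat split; auto.
    intros b Hb. apply HX. rewrite in_app_iff in *. simpl in *. tauto.
  - split; [now apply HX|]. exists l2. repeat split; auto.
    intros b Hb. apply HX. rewrite in_app_iff. simpl. tauto.
Qed.

(** Every vertex on the walk is reached from a vertex of [C] and reaches a vertex of [C] without
    meeting [X]. *)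
Lemma list_walk_scomp X C u l : is_scomp E X C -> C u -> C (last l u) ->
  list_walk u l -> (forall b, In b l -> ~ X b) -> forall a, In a l -> C a.
Proof.
  intros HC Hu Hl Hw HX a Ha.
  rewrite (is_scomp_eq HC Hu) in Hl |- *.
  destruct (@list_walk_split X u l a) as [H1 H2]; auto.
  { exact (is_scomp_notin HC Hu). }
  exact (scomp_between Hl H1 H2).
Qed.

(** By induction on [A]: walk to the next element of [A] that lies in [C] and continue from there.
    The connecting walks exist and stay in [C] as [C] is a strong component. *)
Lemma touring_walk X C u v (A : list V) : is_scomp E X C -> C u -> C v ->
  exists l, list_walk u l /\ last l u = v /\ (forall a, In a l -> C a) /\
    forall a, In a A -> C a -> In a (u :: l).
Proof.
  intro HC.
  assert (H2 : forall u v, C u -> C v ->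
    exists l, list_walk u l /\ last l u = v /\ forall a, In a l -> C a).
  { intros x y Hx Hy. pose proof Hy as Hy'. rewrite (is_scomp_eq HC Hx) in Hy'.
    destruct Hy' as [_ [Hw _]]. apply walk_in_list in Hw.
    destruct Hw as [_ [l [Hl [Hv Ha]]]]. exists l. repeat split; auto.
    apply (@list_walk_scomp X C x l); auto. now rewrite Hv. }
  revert u. induction A as [|a A IH]; intros u Hu Hv.
  - destruct (H2 u v Hu Hv) as [l [Hl [Hlv HlC]]]. exists l. repeat split; auto.
    intros a [].
  - destruct (classic (C a)) as [Ha|Ha].
    + destruct (H2 u a Hu Ha) as [l [Hl [Hlv HlC]]].
      destruct (IH a Ha Hv) as [m [Hm [Hmv [HmC HmA]]]].
      exists (l ++ m). rewrite list_walk_app, last_app, Hlv. repeat split; auto.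
      * intros b Hb. apply in_app_or in Hb. destruct Hb; auto.
      * assert (Hin : forall b, In b (a :: m) -> In b (u :: l ++ m)).
        { intros b [<-|Hb].
          - pose proof (last_in l u) as Hl'. rewrite Hlv in Hl'.
            destruct Hl' as [<-|Hl']; [now left|right; apply in_or_app; auto].
          - right. apply in_or_app. auto. }
        intros b [<-|Hb] HbC; apply Hin; [now left|auto].
    + destruct (IH u Hu Hv) as [m [Hm [Hmv [HmC HmA]]]]. exists m. repeat split; auto.
      intros b [<-|Hb] HbC; [tauto|auto].
Qed.

(* Keeping only the last visit to every vertex turns a locally finite walk into a ray. *)
Lemma locally_finite_walk_ray (w : nat -> V) :
  (forall i, E (w i) (w (S i))) ->
  (forall v, exists N, forall i, (N <= i)%nat -> w i <> v) ->
  exists r, ray E r /\ forall C, tail_in w C -> tail_in r C.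
Proof.
  intros HE Hlf.
  assert (Hlast : forall i, exists j, (i <= j)%nat /\ w j = w i /\
    forall k, (j < k)%nat -> w k <> w j).
  { intro i. destruct (Hlf (w i)) as [N HN].
    (* Induction on the distance [d] to the bound [N]: either [w i] is visited again at some
       [k > i], which is closer to [N], or [i] itself is the last visit. *)
    assert (H : forall d i, (N <= i + d)%nat -> w i <> w i \/
      (forall v, (forall k, (N <= k)%nat -> w k <> v) -> w i = v ->
       exists j, (i <= j)%nat /\ w j = w i /\ forall k, (j < k)%nat -> w k <> w j)).
    { clear. induction d as [|d IH]; intros i Hi; right; intros v Hv Hiv.
      - exfalso. apply (Hv i); [lia|auto].
      - destruct (classic (exists k, (i < k)%nat /\ w k = w i)) as [[k [Hk Hki]]|Hn].
        + destruct (IH k) as [H|H]; [lia|tauto|].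
          destruct (H v Hv) as [j [Hj [Hjk Hlj]]]; [congruence|].
          exists j. repeat split; [lia|congruence|exact Hlj].
        + exists i. repeat split; auto. intros k Hk Hki. apply Hn. now exists k. }
    destruct (H N i) as [Hc|H']; [lia|tauto|]. exact (H' (w i) HN eq_refl). }
  destruct (choice _ Hlast) as [lst Hlst].
  (* Passing to [S (idx k)] uses an edge of the walk, and jumping on to the last visit does not
     change the vertex; so consecutive chosen vertices are joined by an edge. *)
  pose (idx := fix idx k := match k with O => lst O | S k' => lst (S (idx k')) end).
  assert (Hidx : forall k, (idx k < idx (S k))%nat).
  { intro k. change (idx (S k)) with (lst (S (idx k))). destruct (Hlst (S (idx k))). lia. }
  assert (Hmono : forall k m, (k < m)%nat -> (idx k < idx m)%nat).
  { intros k m H. induction H as [|m H IH]; [apply Hidx|]. pose proof (Hidx m). lia. }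
  assert (Hge : forall k, (k <= idx k)%nat).
  { induction k as [|k IH]; [lia|]. pose proof (Hidx k). lia. }
  assert (Hlv : forall k j, (idx k < j)%nat -> w j <> w (idx k)).
  { intros [|k] j; simpl; apply Hlst. }
  exists (fun k => w (idx k)). split; [split|].
  - intros m n Heq. destruct (lt_eq_lt_dec m n) as [[H|H]|H]; [|exact H|].
    + destruct (Hlv m (idx n)); auto.
    + destruct (Hlv n (idx m)); auto.
  - intro n. change (idx (S n)) with (lst (S (idx n))).
    destruct (Hlst (S (idx n))) as [_ [-> _]]. apply HE.
  - intros C [n Hn]. exists n. intros m Hm. apply Hn. pose proof (Hge m). lia.
Qed.

End Walks.

(** * Directions and ends *)

Section Directions.
Context {V : Type} (E : V -> V -> Prop).
Implicit Types (X Y C : V -> Prop) (u v : V).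

Definition direction (f : (V -> Prop) -> V -> Prop) : Prop :=
  (forall X, fin_set X -> is_scomp E X (f X)) /\
  forall X Y, fin_set X -> fin_set Y -> (forall a, X a -> Y a) ->
    forall v, f Y v -> f X v.

Variable f : (V -> Prop) -> V -> Prop.
Hypothesis Hf : direction f.

(** Finite sets are given by lists here, since the constructions below enlarge them stage by
    stage. *)
Let fl (l : list V) : V -> Prop := f (fun v => In v l).

Lemma fl_scomp l : is_scomp E (fun v => In v l) (fl l).
Proof. apply Hf. apply fin_list. Qed.

Lemma fl_mono l m v : incl l m -> fl m v -> fl l v.
Proof. intro H. apply Hf; auto using fin_list. Qed.

Lemma direction_absorb X u v : fin_set X -> f X u -> scomp E X u v -> f X v.
Proof.
  intros HX Hu Hs. now rewrite (is_scomp_eq (proj1 Hf X HX) Hu).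
Qed.

Lemma nth_app_last (l m : list V) u d k :
  nth (length l + k) (u :: l ++ m) d = nth k (last l u :: m) d.
Proof.
  revert u. induction l as [|a l IH]; intro u; [reflexivity|].
  rewrite last_cons, <- IH. reflexivity.
Qed.

(* The walk leaves every finite set, as from stage [n] on it stays in [f (Xs n)], and [Xs n]
   contains what was visited before stage [n]; [G] adds further vertices to be visited or avoided. *)
Lemma direction_walk (G : list V -> list V) (X0 : list V) : exists w Xs,
  (forall i, E (w i) (w (S i))) /\
  (forall v, exists N, forall i, (N <= i)%nat -> w i <> v) /\
  Xs O = X0 /\
  (forall n, incl (Xs n) (Xs (S n)) /\ incl (G (Xs n)) (Xs (S n))) /\
  (forall n a, In a (G (Xs n)) -> fl (Xs n) a -> exists i, (n <= i)%nat /\ w i = a) /\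
  (forall n, exists i, (n <= i)%nat /\ fl (Xs n) (w i)).
Proof.
  destruct (is_scomp_nonempty (fl_scomp X0)) as [x0 Hx0].
  (* A state is the finite set of the stage together with the walk built so far, listed without its
     start [x0]; that walk ends in the component of the stage. *)
  pose (I := fun s : list V * list V =>
    list_walk E x0 (snd s) /\ fl (fst s) (last (snd s) x0)).
  pose (Q := fun s s' : list V * list V =>
    incl (fst s) (fst s') /\ incl (G (fst s)) (fst s') /\ incl (x0 :: snd s) (fst s') /\
    exists W, snd s' = snd s ++ W /\ W <> [] /\ (forall a, In a W -> ~ In a (fst s)) /\
      forall a, In a (G (fst s)) -> fl (fst s) a -> In a (last (snd s) x0 :: W)).
  destruct (@dependent_choice _ I Q (X0, [])) as [s [H0 Hs]].
  { split; [exact Logic.I|exact Hx0]. }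
  { intros [X L] [HL Hx]. simpl in HL, Hx.
    (* All vertices visited so far enter the next finite set, so from the next stage on the walk
       cannot return to them. *)
    pose (X' := X ++ G X ++ x0 :: L).
    assert (HXX' : incl X X') by (intros a Ha; apply in_or_app; auto).
    destruct (is_scomp_nonempty (fl_scomp X')) as [x' Hx'].
    (* By monotonicity [x'] lies in [fl X] too; the walk to it stays in [fl X] and collects the
       vertices of [G X] found there. *)
    destruct (touring_walk (G X) (fl_scomp X) Hx (fl_mono HXX' Hx'))
      as [W [HW [HWl [HWC HWA]]]].
    exists (X', L ++ W). split; [split|]; simpl.
    - rewrite list_walk_app. auto.
    - rewrite last_app, HWl. exact Hx'.
    - repeat split; simpl.
      + exact HXX'.
      + intros a Ha. unfold X'. rewrite !in_app_iff. auto.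
      + intros a Ha. unfold X'. rewrite !in_app_iff. auto.
      + exists W. repeat split; auto.
        (* The target [x'] avoids [X'], which contains the current endpoint. So [W] is not empty,
           and the walk grows at every stage. *)
        * intros ->. simpl in HWl. apply (is_scomp_notin (fl_scomp X') Hx').
          rewrite <- HWl. unfold X'. rewrite !in_app_iff. right; right. apply last_in.
        * intros a Ha. exact (is_scomp_notin (fl_scomp X) (HWC a Ha)). }
  assert (Hpre : forall n m, (n <= m)%nat ->
    incl (fst (s n)) (fst (s m)) /\
    exists W, snd (s m) = snd (s n) ++ W /\ forall a, In a W -> ~ In a (fst (s n))).
  { intros n m H. induction H as [|m H [IH1 [W [HW HWX]]]].
    - split; [apply incl_refl|]. exists []. rewrite app_nil_r. simpl. auto.
    - destruct (Hs m) as [_ [HX [_ [_ [W' [HW' [_ [HWX' _]]]]]]]].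
      split; [exact (incl_tran IH1 HX)|].
      exists (W ++ W'). rewrite HW', HW, app_assoc. split; [reflexivity|].
      intros a Ha. apply in_app_or in Ha. destruct Ha as [Ha|Ha]; [auto|].
      intro Hc. exact (HWX' a Ha (IH1 a Hc)). }
  assert (Hlen : forall n, (n <= length (snd (s n)))%nat).
  { induction n as [|n IH]; [lia|].
    destruct (Hs n) as [_ [_ [_ [_ [W [-> [HW _]]]]]]]. rewrite length_app.
    destruct W; [tauto|]. simpl. lia. }
  (* Stage [i] has at least [i] steps, so index [i] is in range; as later stages extend earlier
     ones, every stage that is long enough gives the same vertex. *)
  pose (w := fun i => nth i (x0 :: snd (s i)) x0).
  assert (Hw : forall n k, (k <= length (snd (s n)))%nat -> w k = nth k (x0 :: snd (s n)) x0).
  { intros n k Hk. unfold w. destruct (Nat.le_ge_cases k n) as [H|H];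
      destruct (Hpre _ _ H) as [_ [W [-> _]]]; rewrite app_comm_cons, app_nth1; auto;
      simpl; [|lia]. pose proof (Hlen k). lia. }
  exists w, (fun n => fst (s n)). split; [|split; [|split; [|split; [|split]]]].
  - intro i. pose proof (Hlen (S i)) as Hi.
    rewrite (Hw (S i) i), (Hw (S i) (S i)) by lia. apply list_walk_nth; [apply Hs|lia].
  - intro v. destruct (classic (exists i, w i = v)) as [[i0 Hi0]|Hn].
    (* From stage [S i0] on [v] belongs to the finite set, and everything appended later avoids that
       set. *)
    + exists (S (length (snd (s (S i0))))). intros i Hi Hiv.
      assert (Hin : In v (fst (s (S i0)))).
      { destruct (Hs i0) as [_ [_ [_ [H _]]]]. apply H. rewrite <- Hi0. unfold w.
        apply nth_In. simpl. pose proof (Hlen i0). lia. }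
      assert (Hle : (S i0 <= i)%nat) by (pose proof (Hlen (S i0)); lia).
      destruct (Hpre _ _ Hle) as [_ [W [HW HWX]]]. apply (HWX v); [|exact Hin].
      rewrite <- Hiv. unfold w. rewrite HW.
      replace i with (length (snd (s (S i0))) + S (i - S (length (snd (s (S i0))))))%nat at 1 by lia.
      rewrite nth_app_last. simpl. apply nth_In.
      pose proof (Hlen i) as Hl. rewrite HW, length_app in Hl. lia.
    + exists O. intros i _ Hi. apply Hn. now exists i.
  - now rewrite H0.
  - intro n. destruct (Hs n) as [_ [H1 [H2 _]]]. auto.
  - intros n a Ha HaC.
    destruct (Hs n) as [_ [_ [_ [_ [W [HW [_ [_ HA]]]]]]]].
    destruct (In_nth _ _ x0 (HA a Ha HaC)) as [k [Hk Hka]].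
    exists (length (snd (s n)) + k)%nat. split; [pose proof (Hlen n); lia|].
    rewrite (Hw (S n)).
    + rewrite HW, nth_app_last. exact Hka.
    + rewrite HW, length_app. simpl in Hk. lia.
  - intro n. exists (length (snd (s n))). split; [apply Hlen|].
    rewrite (Hw n), nth_length_last by lia. apply Hs.
Qed.

(** Once the walk has left the finite set [X] for good, its segments are walks of D - X. A vertex
    between two visits to [f X] therefore lies in that strong component. *)
Lemma direction_tail (w : nat -> V) X : fin_set X ->
  (forall i, E (w i) (w (S i))) ->
  (forall v, exists N, forall i, (N <= i)%nat -> w i <> v) ->
  (forall N, exists i, (N <= i)%nat /\ f X (w i)) ->
  tail_in w (f X).
Proof.
  intros HX HE Hlf Hinf.
  destruct (@fin_unif_nat V X (fun v N => forall i, (N <= i)%nat -> w i <> v)) as [N HN]; auto.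
  { intros s n m _ H Hnm i Hi. apply H. lia. }
  destruct (Hinf N) as [i [Hi Hfi]]. exists i. intros m Hm.
  destruct (Hinf m) as [j [Hj Hfj]].
  assert (Hwalk : forall a b, (i <= a)%nat -> (a <= b)%nat -> walk_in E X (w a) (w b)).
  { intros a b Ha Hb. exists (b - a)%nat, (fun k => w (a + k)%nat). repeat split.
    - f_equal. lia.
    - f_equal. lia.
    - intros k Hk Hc. apply (HN _ Hc (a + k)%nat); [lia|reflexivity].
    - intros k Hk. replace (a + S k)%nat with (S (a + k)) by lia. apply HE. }
  rewrite (is_scomp_eq (proj1 Hf X HX) Hfi) in Hfj |- *.
  apply scomp_between with (v := w j); auto.
Qed.

(** Meeting each [f X] infinitely often is all that has to be arranged: [direction_tail] turns it
    into a tail. *)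
Let touring (w : nat -> V) : Prop :=
  (forall i, E (w i) (w (S i))) /\
  (forall v, exists N, forall i, (N <= i)%nat -> w i <> v) /\
  forall X, fin_set X -> forall N, exists i, (N <= i)%nat /\ f X (w i).

Lemma incl_chain (Xs : nat -> list V) :
  (forall n, incl (Xs n) (Xs (S n))) -> forall n m, (n <= m)%nat -> incl (Xs n) (Xs m).
Proof.
  intros H n m Hnm. induction Hnm as [|m Hnm IH]; [apply incl_refl|].
  exact (incl_tran IH (H m)).
Qed.

Lemma list_diff (B U : list V) : exists A, forall a, In a A <-> In a B /\ ~ In a U.
Proof.
  exists (filter (fun a => if excluded_middle_informative (In a U) then false else true) B).
  intro a. rewrite filter_In.
  destruct excluded_middle_informative; intuition discriminate.
Qed.

(** A vertex outside [U] that occurs in [Gs n] belongs to all [Xs m] with [m > n], and hence to no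
    later [Gs m]. *)
Lemma escaping_sets (X U : V -> Prop) (Gs Xs : nat -> list V) : fin_set X ->
  (forall a, X a -> ~ U a) ->
  (forall n, incl (Xs n) (Xs (S n)) /\ incl (Gs n) (Xs (S n))) ->
  (forall n a, In a (Xs n) -> ~ U a -> ~ In a (Gs n)) ->
  exists N, forall a n, X a -> (N <= n)%nat -> ~ In a (Gs n).
Proof.
  intros HX HXU HXs HG.
  destruct (@fin_unif_nat V X (fun a N => forall n, (N <= n)%nat -> ~ In a (Gs n))) as [N HN];
    auto.
  - intros s n m _ H Hnm k Hk. apply H. lia.
  - intros a Ha. destruct (classic (exists n, In a (Gs n))) as [[n Hn]|Hn].
    + exists (S n). intros m Hm. apply HG; auto.
      apply (@incl_chain Xs (fun k => proj1 (HXs k)) (S n) m Hm). now apply HXs.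
    + exists O. intros n _ Hc. apply Hn. now exists n.
  - exists N. auto.
Qed.

(* The sets [f (Xs n)] are made to have empty intersection, so that [f (Xs n)] avoids a given [X]
   for large [n] and then lies in [f X]. *)
Lemma touring_walk_undominated (U : list V) :
  (forall A : list V, (forall a, In a A -> ~ In a U) ->
    exists Z : list V, (forall a, In a Z -> ~ In a A) /\ forall a, In a A -> ~ fl Z a) ->
  exists w, touring w.
Proof.
  intro HU.
  (* Apply the hypothesis to the part [A] of [B] outside [U]: [G B] is disjoint from [A], and so is
     its component. *)
  assert (HG : exists G : list V -> list V, forall B a, In a B -> ~ In a U ->
    ~ In a (G B) /\ ~ fl (G B) a).
  { apply (choice (fun B Z => forall a, In a B -> ~ In a U -> ~ In a Z /\ ~ fl Z a)).
    intro B. destruct (list_diff B U) as [A HA].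
    destruct (HU A) as [Z [HZ1 HZ2]].
    { intros a Ha. now apply HA in Ha. }
    exists Z. intros a HaB HaU.
    assert (Ha : In a A) by (apply HA; auto).
    split; [intro Hc; exact (HZ1 a Hc Ha)|auto]. }
  destruct HG as [G HG].
  destruct (is_scomp_nonempty (fl_scomp U)) as [x Hx].
  destruct (direction_walk G (x :: U)) as [w [Xs [HE [Hlf [H0 [HXs [_ Hw]]]]]]].
  exists w. repeat split; auto.
  assert (Hinc := @incl_chain Xs (fun k => proj1 (HXs k))).
  assert (HUX : forall n, incl (x :: U) (Xs n)).
  { intro n. rewrite <- H0. apply Hinc. lia. }
  assert (HxU : ~ In x U) by exact (is_scomp_notin (fl_scomp U) Hx).
  (* Suppose [v] lies in all of them. A closed walk in [fl U] from [v] through [x] avoids [U], so it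
     misses [G (Xs N)] for large [N]. It then puts [x] into the component [fl (G (Xs N))] of [v],
     although [x] is in [Xs N] and outside [U]. *)
  assert (Hempty : forall v, exists n, ~ fl (Xs n) v).
  { intro v. apply NNPP. intro Hc.
    assert (Hv : forall n, fl (Xs n) v).
    { intro n. apply NNPP. intro H. apply Hc. now exists n. }
    assert (HvU : fl U v).
    { apply fl_mono with (m := Xs O); auto. intros a Ha. apply (HUX O). now right. }
    destruct (touring_walk [x] (fl_scomp U) HvU HvU) as [l [Hl [Hlv [HlC HlA]]]].
    destruct (@escaping_sets (fun a => In a (v :: l)) (fun a => In a U)
      (fun n => G (Xs n)) Xs) as [N HN]; auto.
    { apply fin_list. }
    { intros a Ha. apply (is_scomp_notin (fl_scomp U)). destruct Ha as [<-|Ha]; auto. }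
    { intros n a Ha HaU. now apply HG. }
    destruct (HG (Xs N) x) as [HxG Hnx]; auto.
    { apply HUX. now left. }
    apply Hnx.
    assert (HvG : fl (G (Xs N)) v).
    { apply fl_mono with (m := Xs (S N)); auto. apply HXs. }
    apply (direction_absorb (fin_list (G (Xs N))) HvG).
    assert (Hvl : ~ In v (G (Xs N))) by (apply (HN v); [now left|lia]).
    assert (Hxl : In x (v :: l)) by (apply HlA; [now left|exact Hx]).
    destruct Hxl as [->|Hxl]; [now apply scomp_refl|].
    destruct (@list_walk_split V E (fun a => In a (G (Xs N))) v l x) as [Hw1 Hw2]; auto.
    { intros b Hb. apply (HN b); [now right|lia]. }
    rewrite Hlv in Hw2. repeat split; auto. }
  intros X HX N.
  destruct (@fin_unif_nat V X (fun v n => ~ fl (Xs n) v)) as [M HM]; auto.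
  { intros s n m _ H Hnm Hc. apply H. apply fl_mono with (m := Xs m); auto. }
  destruct (Hw (N + M)%nat) as [i [Hi Hfi]]. exists i. split; [lia|].
  set (K := (N + M)%nat) in *.
  (* The component of [f] at the union provides a vertex [y] common to [f X] and [fl (Xs K)]. As the
     latter avoids [X], it lies in [f X] completely. *)
  pose (Y := fun a => X a \/ In a (Xs K)).
  assert (HY : fin_set Y) by (apply fin_union; auto using fin_list).
  destruct (is_scomp_nonempty (proj1 Hf Y HY)) as [y Hy].
  assert (HyX : f X y) by (revert Hy; apply Hf; auto; now left).
  assert (HyN : fl (Xs K) y)
    by (revert Hy; apply Hf; auto using fin_list; now right).
  apply (direction_absorb HX HyX).
  assert (HnX : forall a, fl (Xs K) a -> ~ X a).
  { intros a Ha HaX. apply (HM a HaX). apply fl_mono with (m := Xs K); auto.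
    apply Hinc. unfold K. lia. }
  destruct (touring_walk [] (fl_scomp (Xs K)) HyN Hfi) as [l [Hl [Hll [HlC _]]]].
  destruct (touring_walk [] (fl_scomp (Xs K)) Hfi HyN) as [m [Hm [Hml [HmC _]]]].
  repeat split.
  - auto.
  - apply walk_in_list. split; [auto|]. exists l. repeat split; auto.
  - apply walk_in_list. split; [auto|]. exists m. repeat split; auto.
Qed.

(* The sets [G (Xs n)] are disjoint dominating sets, so almost all of them meet [f X]. *)
Lemma touring_walk_dominated :
  (forall U : list V, exists A : list V, (forall a, In a A -> ~ In a U) /\
    forall Z : list V, (forall a, In a Z -> ~ In a A) -> exists a, In a A /\ fl Z a) ->
  exists w, touring w.
Proof.
  intro Hdom. destruct (choice _ Hdom) as [G HG].
  destruct (direction_walk G []) as [w [Xs [HE [Hlf [_ [HXs [Hvis _]]]]]]].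
  exists w. repeat split; auto. intros X HX N.
  destruct (@escaping_sets X (fun _ => False) (fun n => G (Xs n)) Xs) as [M HM]; auto.
  { intros n a Ha _ Hc. exact (proj1 (HG (Xs n)) a Hc Ha). }
  destruct HX as [l Hl].
  (* [l] may list more than [X], so the dominating set is taken out to make [Z] disjoint from it. It
     meets neither [X], by the choice of [M], nor [Xs (N + M)], so both remain within [Z]. *)
  destruct (list_diff (l ++ Xs (N + M)%nat) (G (Xs (N + M)%nat))) as [Z HZ].
  destruct (proj2 (HG (Xs (N + M)%nat)) Z) as [a [Ha HaZ]].
  { intros a Ha. now apply HZ in Ha. }
  destruct (Hvis (N + M)%nat a Ha) as [i [Hi Hia]].
  - apply fl_mono with (m := Z); auto. intros b Hb. apply HZ.
    rewrite in_app_iff. split; [auto|]. intro Hc. exact (proj1 (HG _) b Hc Hb).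
  - exists i. split; [lia|]. rewrite Hia. revert HaZ. apply Hf; [now exists l|apply fin_list|].
    intros b Hb. apply HZ. rewrite in_app_iff. split; [auto|]. apply HM; [exact Hb|lia].
Qed.

Lemma direction_ray : exists r, ray E r /\ forall X, fin_set X -> tail_in r (f X).
Proof.
  assert (H : exists w, touring w).
  { destruct (classic (exists U : list V, forall A : list V,
      (forall a, In a A -> ~ In a U) ->
      exists Z : list V, (forall a, In a Z -> ~ In a A) /\ forall a, In a A -> ~ fl Z a))
      as [[U HU]|Hdom].
    - exact (touring_walk_undominated HU).
    - apply touring_walk_dominated. intro U. apply NNPP. intro Hc. apply Hdom.
      exists U. intros A HA. apply NNPP. intro Hn. apply Hc. exists A. split; [exact HA|].
      intros Z HZ. apply NNPP. intro Hn'. apply Hn. exists Z. split; [exact HZ|].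
      intros a Ha Hfa. apply Hn'. now exists a. }
  destruct H as [w [HE [Hlf Hw]]].
  destruct (locally_finite_walk_ray HE Hlf) as [r [Hr Ht]].
  exists r. split; [exact Hr|]. intros X HX. apply Ht. apply direction_tail; auto.
Qed.

End Directions.

(** * Ends and the components they live in *)

Section Ends.
Context {V : Type} (E : V -> V -> Prop).
Implicit Types (X Y C : V -> Prop) (u v : V) (Om Eta : (nat -> V) -> Prop).

Lemma tail_in_meet (r : nat -> V) C C' : tail_in r C -> tail_in r C' -> exists v, C v /\ C' v.
Proof.
  intros [n Hn] [m Hm]. exists (r (n + m)%nat). split; [apply Hn|apply Hm]; lia.
Qed.

Lemma tail_in_sub (r : nat -> V) C C' :
  tail_in r C -> (forall v, C v -> C' v) -> tail_in r C'.
Proof. intros [n Hn] H. exists n. auto. Qed.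

Lemma scomp_meet X u u' v : scomp E X u v -> scomp E X u' v -> scomp E X u = scomp E X u'.
Proof. intros H H'. rewrite (scomp_eq H), (scomp_eq H'). reflexivity. Qed.

(** All rays of the end have tails in the strong component that contains a tail of the defining ray
    [r0], and [CX] is that component. *)
Lemma end_component Om X : is_end E Om -> fin_set X ->
  is_scomp E X (CX E X Om) /\ forall r, Om r -> tail_in r (CX E X Om).
Proof.
  intros [r0 [[Hr0 Hs] HOm]] HX.
  destruct (Hs X HX) as [u [Hu Htu]].
  assert (Ht : forall r, Om r -> tail_in r (scomp E X u)).
  { intros r Hr. apply HOm in Hr. destruct Hr as [_ Heq].
    destruct (Heq X HX) as [u' [_ [H1 H2]]].
    destruct (tail_in_meet Htu H1) as [v [Hv Hv']].
    now rewrite (scomp_meet Hv Hv'). }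
  assert (HC : CX E X Om = scomp E X u).
  { apply set_ext. intro v. split.
    - intros [r [Hr [n Hn]]]. destruct (Ht r Hr) as [m Hm].
      apply scomp_trans with (r (n + m)%nat); [apply Hm|apply Hn]; lia.
    - intro Hv. exists r0. split.
      + apply HOm. split; [split; auto|]. intros Y HY.
        destruct (Hs Y HY) as [u' [Hu' Ht']]. exists u'. auto.
      + destruct Htu as [n Hn]. exists n. intros m Hm.
        apply scomp_trans with u; [apply scomp_sym; auto|exact Hv]. }
  rewrite HC. split; [now exists u|exact Ht].
Qed.

Lemma end_inhabited Om : is_end E Om -> exists r, Om r.
Proof.
  intros [r [Hr HOm]]. exists r. apply HOm. split; [exact Hr|].
  intros X HX. destruct Hr as [_ Hs]. destruct (Hs X HX) as [u Hu]. exists u. tauto.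
Qed.

Lemma end_component_mono Om X Y v : is_end E Om -> fin_set X -> fin_set Y ->
  (forall a, X a -> Y a) -> CX E Y Om v -> CX E X Om v.
Proof.
  intros HOm HX HY HXY Hv.
  destruct (end_component HOm HX) as [HC1 HC2].
  destruct (end_component HOm HY) as [HC1' HC2'].
  destruct (end_inhabited HOm) as [r Hr].
  destruct (tail_in_meet (HC2 r Hr) (HC2' r Hr)) as [a [Ha Ha']].
  rewrite (is_scomp_eq HC1 Ha). rewrite (is_scomp_eq HC1' Ha') in Hv.
  exact (scomp_mono HXY Hv).
Qed.

Lemma lives_component Om Eta X : is_end E Om -> is_end E Eta -> fin_set X ->
  (lives Eta (CX E X Om) <-> CX E X Eta = CX E X Om).
Proof.
  intros HOm HEta HX.
  destruct (end_component HOm HX) as [HC1 HC2].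
  destruct (end_component HEta HX) as [HC1' HC2'].
  split.
  - intros [r [Hr Ht]]. destruct (tail_in_meet Ht (HC2' r Hr)) as [a [Ha Ha']].
    now rewrite (is_scomp_eq HC1 Ha), (is_scomp_eq HC1' Ha').
  - intro Heq. destruct (end_inhabited HEta) as [r Hr]. exists r. rewrite <- Heq. auto.
Qed.

(** Equivalence of solid rays only asks in which strong component of each D - X they have tails, and
    [CX] records exactly this. *)
Lemma end_ext Om Eta : is_end E Om -> is_end E Eta ->
  (forall X, fin_set X -> CX E X Om = CX E X Eta) -> Om = Eta.
Proof.
  assert (Hsub : forall Om Eta, is_end E Om -> is_end E Eta ->
    (forall X, fin_set X -> CX E X Om = CX E X Eta) -> forall r, Om r -> Eta r).
  { clear. intros Om Eta HOm HEta Heq r Hr.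
    pose proof HOm as [r1 [_ HOm1]]. pose proof HEta as [r2 [Hr2 HEta2]].
    apply HEta2. split; [now apply HOm1|]. intros X HX.
    destruct (end_component HOm HX) as [_ Ht].
    destruct (end_component HEta HX) as [[u [Hu HC]] Ht'].
    exists u. rewrite <- HC. repeat split; auto.
    - apply Ht'. apply HEta2. split; [exact Hr2|].
      intros Y HY. destruct (proj2 Hr2 Y HY) as [u' Hu']. exists u'. tauto.
    - rewrite <- Heq by auto. auto. }
  intros HOm HEta Heq. apply set_ext. intro r. split; apply Hsub; auto.
  intros X HX. symmetry. auto.
Qed.

(** The end is the class of the ray from [direction_ray], which is solid because it has a tail in
    each component [f X]. *)
Lemma direction_end f : direction E f ->
  exists Om, is_end E Om /\ forall X, fin_set X -> CX E X Om = f X.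
Proof.
  intro Hf. destruct (direction_ray Hf) as [r [Hr Ht]].
  assert (Hs : solid_ray E r).
  { split; [exact Hr|]. intros X HX. destruct (proj1 Hf X HX) as [u [Hu Heq]].
    exists u. rewrite <- Heq. auto. }
  pose (Om := fun r' => solid_ray E r' /\ ray_equiv E r r').
  assert (HOm : is_end E Om) by (exists r; split; [exact Hs|]; reflexivity).
  exists Om. split; [exact HOm|]. intros X HX.
  destruct (end_component HOm HX) as [HC HCt].
  assert (Hr' : Om r).
  { split; [exact Hs|]. intros Y HY. destruct (proj2 Hs Y HY) as [u Hu]. exists u. tauto. }
  destruct (tail_in_meet (HCt r Hr') (Ht X HX)) as [v [Hv Hv']].
  now rewrite (is_scomp_eq HC Hv), (is_scomp_eq (proj1 Hf X HX) Hv').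
Qed.

End Ends.

(** * Admissible partitions *)

Section Partitions.
Context {V : Type} (E : V -> V -> Prop).
Implicit Types (X Y p q : V -> Prop) (u v : V) (Om Eta : (nat -> V) -> Prop)
  (P : (V -> Prop) -> Prop) (a b : node V).

Definition valid a : Prop := match a with inl _ => True | inr Om => is_end E Om end.

(** For admissible [P] this is what makes [comp_part X] a refinement of [P]; see
    [resolves_refines]. *)
Definition resolves P X : Prop :=
  forall u v p, scomp E X u v -> P p -> p u -> p v.

Lemma class_eq P p q v : admissible E P -> P p -> P q -> p v -> q v -> p = q.
Proof. intros [_ [_ [_ [H _]]]]. apply H. Qed.

Lemma cls_eq P p v : admissible E P -> P p -> p v -> cls P v = p.
Proof.
  intros HP Hp Hv. apply set_ext. intro w. split.
  - intros [q [Hq [Hqv Hqw]]]. now rewrite (class_eq HP Hp Hq Hv Hqv).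
  - intro Hw. exists p. auto.
Qed.

Lemma clsE_eq P p X Om : admissible E P -> is_end E Om -> fin_set X -> P p ->
  (forall v, CX E X Om v -> p v) -> clsE P Om = p.
Proof.
  intros HP HOm HX Hp H.
  assert (Ht : forall r, Om r -> tail_in r p).
  { intros r Hr. apply tail_in_sub with (2 := H). now apply (end_component HOm HX). }
  apply set_ext. intro w. split.
  - intros [q [Hq [Hw Hqt]]]. destruct (end_inhabited HOm) as [r Hr].
    destruct (tail_in_meet (Ht r Hr) (Hqt r Hr)) as [v [Hv Hv']].
    now rewrite (class_eq HP Hp Hq Hv Hv').
  - intro Hw. exists p. auto.
Qed.

Lemma resolves_mono P X Y : (forall v, X v -> Y v) -> resolves P X -> resolves P Y.
Proof. intros H HX u v p Hs. apply HX. exact (scomp_mono H Hs). Qed.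

Lemma separates_mono Y Y' p q : (forall v, Y v -> Y' v) ->
  separates E Y p q -> separates E Y' p q.
Proof.
  intros H [Hs|Hs]; [left|right]; intros n w Hw H0 Hn;
    destruct (Hs n w Hw H0 Hn) as [i [Hi HYi]]; exists i; auto.
Qed.

Lemma separates_scomp X p q u v : separates E X p q -> p u -> q v -> ~ scomp E X u v.
Proof.
  intros Hs Hu Hv [_ [H1 H2]].
  destruct (walk_in_path H1) as [n [w [Hw [H0 [Hn HX]]]]].
  destruct (walk_in_path H2) as [n' [w' [Hw' [H0' [Hn' HX']]]]].
  destruct Hs as [Hs|Hs].
  - destruct (Hs n w Hw) as [i [Hi Hc]]; [congruence|congruence|exact (HX i Hi Hc)].
  - destruct (Hs n' w' Hw') as [i [Hi Hc]]; [congruence|congruence|exact (HX' i Hi Hc)].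
Qed.

(** Let [X] be the union of separators for all pairs of classes. Two vertices of one strong
    component of D - X are joined by paths avoiding [X] in both directions, so they cannot lie in
    different classes. *)
Lemma resolving_set P : admissible E P -> exists X, fin_set X /\ resolves P X.
Proof.
  intros [Hfin [_ [Hcov [Huniq Hsep]]]].
  assert (H : exists X, fin_set X /\
    forall p, P p -> forall q, P q -> p <> q -> separates E X p q).
  { apply fin_unif with (Q := fun p X => forall q, P q -> p <> q -> separates E X p q); auto.
    - intros p X X' _ H HXX' q Hq Hpq. apply separates_mono with X; auto.
    - intros p Hp.
      apply fin_unif with (Q := fun q X => p <> q -> separates E X p q); auto.
      + intros q X X' _ H HXX' Hpq. apply separates_mono with X; auto.
      + intros q Hq. destruct (classic (p = q)) as [Heq|Hne].
        * exists (fun _ => False). split; [exists []; tauto|]. tauto.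
        * destruct (Hsep p q Hp Hq Hne) as [Y [HY HYs]]. exists Y. auto. }
  destruct H as [X [HX H]]. exists X. split; [exact HX|].
  intros u v p Hs Hp Hu. destruct (Hcov v) as [q [Hq Hv]].
  destruct (classic (p = q)) as [->|Hne]; [exact Hv|].
  destruct (separates_scomp (H p Hp q Hq Hne) Hu Hv Hs).
Qed.

(** The class of one vertex of [CX E X Om] contains the whole component, as [X] resolves [P], and
    with it tails of all rays of the end. *)
Lemma component_class P X Om : admissible E P -> fin_set X -> resolves P X -> is_end E Om ->
  P (clsE P Om) /\ forall v, CX E X Om v -> clsE P Om v.
Proof.
  intros HP HX Hr HOm.
  destruct (end_component HOm HX) as [HC _].
  destruct (is_scomp_nonempty HC) as [u Hu].
  pose proof HP as [_ [_ [Hcov _]]]. destruct (Hcov u) as [p [Hp Hpu]].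
  assert (Hsub : forall v, CX E X Om v -> p v).
  { intros v Hv. rewrite (is_scomp_eq HC Hu) in Hv. exact (Hr u v p Hv Hp Hpu). }
  rewrite (clsE_eq HP HOm HX Hp Hsub). auto.
Qed.

Lemma nodeimg_class P a : admissible E P -> valid a -> P (nodeimg P a).
Proof.
  intros HP. destruct a as [v|Om]; intro Ha; simpl.
  - pose proof HP as [_ [_ [Hcov _]]]. destruct (Hcov v) as [p [Hp Hv]].
    now rewrite (cls_eq HP Hp Hv).
  - destruct (resolving_set HP) as [X [HX Hr]]. now apply (component_class HP HX Hr Ha).
Qed.

Lemma cls_self P v : admissible E P -> cls P v v.
Proof. intros [_ [_ [Hcov _]]]. destruct (Hcov v) as [p [Hp Hv]]. exists p. auto. Qed.

Lemma class_nonempty P p : admissible E P -> P p -> exists v, p v.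
Proof. intros [_ [H _]]. apply H. Qed.

(** Continuity at ends rests on this: once [X] resolves [P], the nodes of a component collapse to a
    single class. *)
Lemma nodeimg_inComp P X Om a : admissible E P -> fin_set X -> resolves P X ->
  is_end E Om -> valid a -> inComp (CX E X Om) a -> nodeimg P a = clsE P Om.
Proof.
  intros HP HX Hr HOm Ha Hin.
  destruct (component_class HP HX Hr HOm) as [Hc Hsub].
  destruct a as [v|Eta]; simpl in *.
  - apply (cls_eq HP Hc). auto.
  - apply (lives_component HOm Ha HX) in Hin.
    apply (clsE_eq HP Ha HX Hc). rewrite Hin. exact Hsub.
Qed.

Lemma nodeimg_refines P P' a v : refines P P' -> nodeimg P' a v -> nodeimg P a v.
Proof.
  intro H. destruct a as [u|Om]; simpl.
  - intros [p' [Hp' [Hu Hv]]]. destruct (H p' Hp') as [p [Hp Hsub]]. exists p. auto.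
  - intros [p' [Hp' [Hv Ht]]]. destruct (H p' Hp') as [p [Hp Hsub]]. exists p.
    repeat split; auto. intros r Hr. exact (tail_in_sub (Ht r Hr) Hsub).
Qed.

Lemma cover_eq P p p' u : admissible E P -> P p -> p' u -> (forall v, p' v -> p v) ->
  cover P p' = p.
Proof.
  intros HP Hp Hu Hsub. apply set_ext. intro w. split.
  - intros [q [Hq [[v [Hv Hqv]] Hw]]]. now rewrite (class_eq HP Hp Hq (Hsub v Hv) Hqv).
  - intro Hw. exists p. repeat split; auto. exists u. auto.
Qed.

Lemma cover_nodeimg P P' a : admissible E P -> admissible E P' -> refines P P' -> valid a ->
  cover P (nodeimg P' a) = nodeimg P a.
Proof.
  intros HP HP' Href Ha.
  destruct (class_nonempty HP' (nodeimg_class HP' Ha)) as [u Hu].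
  apply (cover_eq HP (nodeimg_class HP Ha) Hu).
  intros v. now apply nodeimg_refines.
Qed.

Lemma cover_refines P P' p' v : admissible E P -> admissible E P' -> refines P P' ->
  P' p' -> p' v -> P (cover P p') /\ cover P p' v.
Proof.
  intros HP HP' Href Hp' Hv. destruct (Href p' Hp') as [p [Hp Hsub]].
  rewrite (cover_eq HP Hp Hv Hsub). auto.
Qed.

(** This is the partition P_X; [eq v] is the singleton of [v]. *)
Definition comp_part X : (V -> Prop) -> Prop :=
  fun p => (exists v, X v /\ p = eq v) \/ is_scomp E X p.

Hypothesis Hsolid : solid E.

Lemma comp_part_admissible X : fin_set X -> admissible E (comp_part X).
Proof.
  intro HX. repeat split.
  - destruct HX as [l Hl]. destruct (Hsolid (X := X)) as [m Hm]; [now exists l|].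
    exists (map (@eq V) l ++ m). intros p [[v [Hv ->]]|Hp]; apply in_or_app; auto.
    left. apply in_map. auto.
  - intros p [[v [Hv ->]]|Hp]; [now exists v|exact (is_scomp_nonempty Hp)].
  - intro v. destruct (classic (X v)) as [Hv|Hv].
    + exists (eq v). split; [left; now exists v|reflexivity].
    + exists (scomp E X v). split; [right; now exists v|now apply scomp_refl].
  - intros p q v [[u [Hu ->]]|Hp] [[w [Hw ->]]|Hq] Hv Hv'.
    + congruence.
    + subst u. now destruct (is_scomp_notin Hq Hv').
    + subst w. now destruct (is_scomp_notin Hp Hv).
    + now rewrite (is_scomp_eq Hp Hv), (is_scomp_eq Hq Hv').
  (* [X] itself separates distinct classes: a singleton class lies in [X], and two components joined
     in both directions by paths avoiding [X] would coincide. *)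
  - intros p q Hp Hq Hne. exists X. split; [exact HX|].
    destruct Hp as [[u [Hu ->]]|Hp].
    { left. intros n w _ H0 _. exists O. split; [lia|now rewrite <- H0]. }
    destruct Hq as [[u [Hu ->]]|Hq].
    { left. intros n w _ _ Hn. exists n. split; [lia|now rewrite <- Hn]. }
    apply NNPP. intro Hc. apply Hne.
    assert (H : forall p q, ~ all_paths_meet E X p q -> exists u v, p u /\ q v /\ walk_in E X u v).
    { clear. intros p q H. apply NNPP. intro Hc. apply H. intros n w Hw H0 Hn.
      apply NNPP. intro Hm. apply Hc. exists (w O), (w n). repeat split; auto.
      apply path_walk_in; auto. intros i Hi HXi. apply Hm. now exists i. }
    destruct (H p q) as [u [v [Hu [Hv H1]]]]; [intro; apply Hc; now left|].
    destruct (H q p) as [v' [u' [Hv' [Hu' H2]]]]; [intro; apply Hc; now right|].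
    rewrite (is_scomp_eq Hp Hu) in Hu' |- *. rewrite (is_scomp_eq Hq Hv) in Hv' |- *.
    apply scomp_eq. repeat split.
    + exact (is_scomp_notin Hp Hu).
    + exact H1.
    + destruct Hv' as [_ [Hv' _]]. destruct Hu' as [_ [_ Hu']].
      exact (walk_in_trans (walk_in_trans Hv' H2) Hu').
Qed.

Lemma comp_part_vertex X v : fin_set X -> X v -> cls (comp_part X) v = eq v.
Proof.
  intros HX Hv. apply (cls_eq (comp_part_admissible HX)); [|reflexivity].
  left. now exists v.
Qed.

Lemma comp_part_resolves X : fin_set X -> resolves (comp_part X) X.
Proof.
  intros HX u v p Hs [[w [Hw ->]]|Hp] Hu.
  - subst w. destruct Hs. tauto.
  - now rewrite (is_scomp_eq Hp Hu).
Qed.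

Lemma comp_part_end X Om : fin_set X -> is_end E Om -> clsE (comp_part X) Om = CX E X Om.
Proof.
  intros HX HOm. apply (clsE_eq (comp_part_admissible HX) HOm HX); [|auto].
  right. now apply end_component.
Qed.

Lemma resolves_refines P X : admissible E P -> resolves P X -> refines P (comp_part X).
Proof.
  intros [_ [_ [Hcov _]]] Hr p' [[v [Hv ->]]|[u [Hu ->]]].
  - destruct (Hcov v) as [p [Hp Hpv]]. exists p. split; [exact Hp|]. now intros ? <-.
  - destruct (Hcov u) as [p [Hp Hpv]]. exists p. split; [exact Hp|].
    intros w Hw. exact (Hr u w p Hw Hp Hpv).
Qed.

Lemma comp_part_refines X Y : fin_set X -> (forall v, X v -> Y v) ->
  refines (comp_part X) (comp_part Y).
Proof.
  intros HX H. apply resolves_refines; [now apply comp_part_admissible|].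
  apply resolves_mono with X; auto using comp_part_resolves.
Qed.

(** Together with [nodeimg_singleton] this determines exactly the nodes over a class of P_X, so that
    subbasic sets become full preimages. *)
Lemma nodeimg_comp_part X Om a : fin_set X -> is_end E Om -> valid a ->
  (nodeimg (comp_part X) a = CX E X Om <-> inComp (CX E X Om) a).
Proof.
  intros HX HOm Ha. split.
  - destruct a as [v|Eta]; simpl; intro Heq.
    + rewrite <- Heq. apply cls_self. now apply comp_part_admissible.
    + rewrite comp_part_end in Heq by auto. now apply (lives_component HOm Ha HX).
  - intro H. rewrite <- (comp_part_end HX HOm).
    apply nodeimg_inComp with X; auto using comp_part_admissible, comp_part_resolves.
Qed.

Lemma nodeimg_singleton X v a : fin_set X -> X v -> valid a ->
  (nodeimg (comp_part X) a = eq v <-> a = inl v).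
Proof.
  intros HX Hv Ha. split.
  - destruct a as [u|Om]; simpl; intro Heq.
    + pose proof (cls_self u (comp_part_admissible HX)) as Hu. rewrite Heq in Hu. now subst.
    + rewrite comp_part_end in Heq by auto.
      destruct (end_component Ha HX) as [HC _].
      destruct (is_scomp_notin (v := v) HC); [|exact Hv]. now rewrite Heq.
  - intros ->. now apply comp_part_vertex.
Qed.

(** A vertex [v] is recognised by its singleton class when [X] is the set of [v] alone; ends are
    compared by [end_ext]. *)
Lemma node_ext a b : valid a -> valid b ->
  (forall X, fin_set X -> nodeimg (comp_part X) a = nodeimg (comp_part X) b) -> a = b.
Proof.
  assert (Hv : forall v b, valid b ->
    (forall X, fin_set X -> nodeimg (comp_part X) (inl v) = nodeimg (comp_part X) b) ->
    b = inl v).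
  { clear a b. intros v b Hb H. assert (HX : fin_set (eq v)).
    { exists [v]. intros ? <-. now left. }
    apply (nodeimg_singleton HX eq_refl Hb). rewrite <- H by exact HX.
    now apply comp_part_vertex. }
  destruct a as [v|Om], b as [w|Eta]; intros Ha Hb H.
  - symmetry. now apply Hv.
  - symmetry. now apply Hv.
  - apply Hv; [exact Ha|]. intros X HX. symmetry. auto.
  - f_equal. apply (end_ext Ha Hb). intros X HX.
    rewrite <- !comp_part_end by auto. now apply H.
Qed.

(** If some [g X0] is the singleton of a vertex [v] of [X0], then the class at the union of [X] and
    [X0] is nonempty and contained in it, so [v] lies in every [g X]. Otherwise all [g X] are
    components, and [g] is a direction. *)
Lemma node_family (g : (V -> Prop) -> V -> Prop) :
  (forall X, fin_set X -> comp_part X (g X)) ->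
  (forall X Y, fin_set X -> fin_set Y -> (forall v, X v -> Y v) -> forall v, g Y v -> g X v) ->
  exists a, valid a /\ forall X, fin_set X -> nodeimg (comp_part X) a = g X.
Proof.
  intros Hg Hmono.
  destruct (classic (exists X v, fin_set X /\ X v /\ g X = eq v)) as [[X0 [v [HX0 [Hv H0]]]]|Hn].
  - exists (inl v). split; [exact I|]. intros X HX. simpl.
    apply (cls_eq (comp_part_admissible HX) (Hg X HX)).
    assert (HY : fin_set (fun w => X w \/ X0 w)) by now apply fin_union.
    destruct (class_nonempty (comp_part_admissible HY) (Hg _ HY)) as [w Hw].
    assert (Hw0 : g X0 w) by (revert Hw; apply Hmono; auto).
    rewrite H0 in Hw0. subst w. revert Hw. apply Hmono; auto.
  - destruct (@direction_end V E g) as [Om [HOm H]].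
    + split; [|exact Hmono]. intros X HX. destruct (Hg X HX) as [[v [Hv Heq]]|H]; [|exact H].
      destruct Hn. exists X, v. auto.
    + exists (inr Om). split; [exact HOm|]. intros X HX. simpl.
      rewrite comp_part_end by auto. auto.
Qed.

End Partitions.

(** * The projections and the points of the limit *)

Section Projections.
Context {V : Type} (E : V -> V -> Prop).
Implicit Types (X Y p q : V -> Prop) (u v : V) (Om Eta : (nat -> V) -> Prop)
  (P : (V -> Prop) -> Prop) (a b : node V) (x : dpt V).

Lemma inf_edges_mono p q p' q' : (forall v, p' v -> p v) -> (forall v, q' v -> q v) ->
  inf_edges E p' q' -> inf_edges E p q.
Proof.
  intros Hp Hq H Hc. apply H. apply (fin_sub Hc). intros e [H1 [H2 H3]]. auto.
Qed.

Lemma inf_edges_inhabited p q : inf_edges E p q -> exists u v, E u v /\ p u /\ q v.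
Proof.
  intro H. apply NNPP. intro Hc. apply H. exists []. intros [u v] He. apply Hc.
  now exists u, v.
Qed.

Lemma sepE_neq X Om Eta : sepE E X Om Eta <-> CX E X Om <> CX E X Eta.
Proof.
  split; intros H Hc; apply H.
  - intro v. now rewrite Hc.
  - now apply set_ext.
Qed.

(* Adding the ends of finitely many edges to [X] would destroy all of them. *)
Lemma limedge_inf P a b : admissible E P -> limedge E a b ->
  nodeimg P a <> nodeimg P b -> inf_edges E (nodeimg P a) (nodeimg P b).
Proof.
  intros HP Hab Hne [l Hl].
  destruct (resolving_set HP) as [X [HX Hr]].
  pose (Y := fun v => X v \/ (In v (map fst l) \/ In v (map snd l))).
  assert (HY : fin_set Y) by (apply fin_union; auto; apply fin_union; apply fin_list).
  assert (HrY : resolves E P Y) by (apply resolves_mono with X; auto; now left).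
  assert (Hfst : forall u v, In (u, v) l -> Y u).
  { intros u v H. right; left. now apply (in_map fst) in H. }
  assert (Hsnd : forall u v, In (u, v) l -> Y v).
  { intros u v H. right; right. now apply (in_map snd) in H. }
  assert (Hnot : forall Om v, is_end E Om -> CX E Y Om v -> ~ Y v).
  { intros Om v HOm. apply is_scomp_notin with E. now apply end_component. }
  destruct a as [v|Om], b as [w|Eta]; simpl in Hab; [tauto| | |].
  - destruct Hab as [HEta Hab].
    destruct (component_class HP HY HrY HEta) as [_ Hsub].
    destruct (Hab Y HY) as [u [Hu HC]].
    { intro Hc. apply Hne. now apply (nodeimg_inComp (a := inl v) HP HY HrY HEta I). }
    apply (Hnot Eta u HEta HC). apply (Hsnd v). apply Hl. simpl.
    repeat split; auto. now apply cls_self with E.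
  - destruct Hab as [HOm Hab].
    destruct (component_class HP HY HrY HOm) as [_ Hsub].
    destruct (Hab Y HY) as [u [Hu HC]].
    { intro Hc. apply Hne. symmetry. now apply (nodeimg_inComp (a := inl w) HP HY HrY HOm I). }
    apply (Hnot Om u HOm HC). apply (Hfst u w). apply Hl. simpl.
    repeat split; auto. now apply cls_self with E.
  - destruct Hab as [HOm [HEta [_ Hab]]].
    destruct (component_class HP HY HrY HOm) as [_ Hsub].
    destruct (component_class HP HY HrY HEta) as [_ Hsub'].
    destruct (Hab Y HY) as [u [w [Hu [HC HC']]]].
    { apply sepE_neq. intro Hc. apply Hne.
      apply (nodeimg_inComp (a := inr Om) HP HY HrY HEta HOm).
      now apply (lives_component HEta HOm HY). }
    apply (Hnot Om u HOm HC). apply (Hfst u w). apply Hl. simpl. auto.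
Qed.

(** The label used by [phi], split off so that one formula, [phi_inner], covers edges and limit
    edges. *)
Definition arc_label P a b : option (V * V) :=
  match a, b with
  | inl u, inl w =>
      if excluded_middle_informative (inf_edges E (nodeimg P a) (nodeimg P b))
      then None else Some (u, w)
  | _, _ => None
  end.

Lemma phi_inner P a b t : phi E P (DI a b t) =
  if excluded_middle_informative (nodeimg P a = nodeimg P b) then QN (nodeimg P a)
  else QE (arc_label P a b) (nodeimg P a) (nodeimg P b) t.
Proof. destruct a, b; reflexivity. Qed.

Lemma phi_inner_eq P a b t : nodeimg P a = nodeimg P b ->
  phi E P (DI a b t) = QN (nodeimg P a).
Proof.
  intro H. rewrite phi_inner. destruct excluded_middle_informative; tauto.
Qed.

Lemma phi_inner_neq P a b t : nodeimg P a <> nodeimg P b ->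
  phi E P (DI a b t) = QE (arc_label P a b) (nodeimg P a) (nodeimg P b) t.
Proof.
  intro H. rewrite phi_inner. destruct excluded_middle_informative; tauto.
Qed.

Lemma arc_label_inf P a b : inf_edges E (nodeimg P a) (nodeimg P b) -> arc_label P a b = None.
Proof.
  intro H. destruct a, b; try reflexivity. unfold arc_label.
  destruct excluded_middle_informative; tauto.
Qed.

(** By [limedge_inf] a limit edge would force infinitely many edges, so the arc is an edge of
    [E]. *)
Lemma arc_label_fin P a b : admissible E P -> arc E a b -> nodeimg P a <> nodeimg P b ->
  ~ inf_edges E (nodeimg P a) (nodeimg P b) ->
  exists u w, a = inl u /\ b = inl w /\ E u w /\ arc_label P a b = Some (u, w).
Proof.
  intros HP [[u [w [-> [-> Huw]]]]|Hab] Hne Hfin.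
  - exists u, w. repeat split; auto. unfold arc_label.
    destruct excluded_middle_informative; tauto.
  - now destruct Hfin; apply limedge_inf.
Qed.

Hypothesis Hloop : forall v, ~ E v v.

Lemma arc_valid a b : arc E a b -> valid E a /\ valid E b /\ a <> b.
Proof.
  intros [[u [w [-> [-> Huw]]]]|Hab].
  - repeat split. intro Hc. injection Hc as ->. exact (Hloop Huw).
  - destruct a as [v|Om], b as [w|Eta]; simpl in Hab |- *.
    + tauto.
    + repeat split; try tauto. discriminate.
    + repeat split; try tauto. discriminate.
    + repeat split; try tauto. intro Hc. injection Hc as ->.
      destruct Hab as [_ [_ [Hc _]]]. apply Hc. intro r. reflexivity.
Qed.

Lemma arc_qedge P a b : admissible E P -> arc E a b -> nodeimg P a <> nodeimg P b ->
  qedge E P (arc_label P a b) (nodeimg P a) (nodeimg P b).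
Proof.
  intros HP Hab Hne. destruct (arc_valid Hab) as [Ha [Hb _]].
  split; [exact (nodeimg_class HP Ha)|]. split; [exact (nodeimg_class HP Hb)|].
  split; [exact Hne|].
  destruct (classic (inf_edges E (nodeimg P a) (nodeimg P b))) as [Hi|Hi].
  - now rewrite (arc_label_inf Hi).
  - destruct (arc_label_fin HP Hab Hne Hi) as [u [w [-> [-> [Huw ->]]]]].
    split; [exact Huw|]. split; [exact (cls_self u HP)|]. split; [exact (cls_self w HP)|].
    exact Hi.
Qed.

(** A vertex or an end counts as its own tail and head, and likewise for [src] and [tgt] in D/P.
    Tails and heads of points can then be treated as two separate families of nodes. *)
Definition tail_node x : node V :=
  match x with DV v => inl v | DE Om => inr Om | DI a _ _ => a end.
Definition head_node x : node V :=
  match x with DV v => inl v | DE Om => inr Om | DI _ b _ => b end.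
Definition src (y : qpt V) : V -> Prop := match y with QN p => p | QE _ p _ _ => p end.
Definition tgt (y : qpt V) : V -> Prop := match y with QN p => p | QE _ _ q _ => q end.

Lemma src_phi P x : src (phi E P x) = nodeimg P (tail_node x).
Proof.
  destruct x as [v|Om|a b t]; try reflexivity.
  rewrite phi_inner. destruct excluded_middle_informative; reflexivity.
Qed.

Lemma tgt_phi P x : tgt (phi E P x) = nodeimg P (head_node x).
Proof.
  destruct x as [v|Om|a b t]; try reflexivity.
  rewrite phi_inner. destruct excluded_middle_informative as [H|H]; [exact H|reflexivity].
Qed.

Lemma src_fmap P y : src (fmap E P y) = cover P (src y).
Proof.
  destruct y as [p|l p q t]; [reflexivity|]. simpl.
  destruct excluded_middle_informative; reflexivity.
Qed.

Lemma tgt_fmap P y : tgt (fmap E P y) = cover P (tgt y).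
Proof.
  destruct y as [p|l p q t]; [reflexivity|]. simpl.
  destruct excluded_middle_informative as [H|H]; [exact H|reflexivity].
Qed.

Lemma carrierQ_ends P y : carrierQ E P y -> P (src y) /\ P (tgt y).
Proof.
  destruct y as [p|l p q t]; simpl; [auto|]. intros [[H1 [H2 _]] _]. auto.
Qed.

Lemma carrierD_valid x : carrierD E x -> valid E (tail_node x) /\ valid E (head_node x).
Proof.
  destruct x as [v|Om|a b t]; simpl; auto. intros [Hab _].
  destruct (arc_valid Hab) as [Ha [Hb _]]. auto.
Qed.

Lemma phi_carrier P x : admissible E P -> carrierD E x -> carrierQ E P (phi E P x).
Proof.
  intros HP Hx. destruct x as [v|Om|a b t].
  - exact (nodeimg_class (a := inl v) HP I).
  - exact (nodeimg_class (a := inr Om) HP Hx).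
  - destruct Hx as [Hab Ht]. destruct (arc_valid Hab) as [Ha _].
    rewrite phi_inner. destruct excluded_middle_informative as [H|H].
    + exact (nodeimg_class HP Ha).
    + split; [now apply arc_qedge|exact Ht].
Qed.

Lemma phi_fmap P P' x : admissible E P -> admissible E P' -> refines P P' ->
  carrierD E x -> fmap E P (phi E P' x) = phi E P x.
Proof.
  intros HP HP' Href Hx. destruct x as [v|Om|a b t].
  - simpl. f_equal. exact (cover_nodeimg (a := inl v) HP HP' Href I).
  - simpl. f_equal. exact (cover_nodeimg (a := inr Om) HP HP' Href Hx).
  - destruct Hx as [Hab Ht]. destruct (arc_valid Hab) as [Ha [Hb _]].
    pose proof (cover_nodeimg HP HP' Href Ha) as Hca.
    pose proof (cover_nodeimg HP HP' Href Hb) as Hcb.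
    destruct (classic (nodeimg P' a = nodeimg P' b)) as [Heq'|Hne'].
    + rewrite (phi_inner_eq t Heq'). simpl. rewrite Hca.
      symmetry. apply phi_inner_eq. congruence.
    + rewrite (phi_inner_neq t Hne'), phi_inner. simpl. rewrite Hca, Hcb.
      destruct excluded_middle_informative as [Heq|Hne]; [reflexivity|].
      f_equal. destruct excluded_middle_informative as [Hi|Hi].
      * now rewrite arc_label_inf.
      (* Finitely many edges between the coarser classes leave only finitely many between the finer
         ones, so both labels are the same edge. *)
      * assert (Hi' : ~ inf_edges E (nodeimg P' a) (nodeimg P' b)).
        { intro Hc. apply Hi. revert Hc.
          apply inf_edges_mono; intro v; now apply nodeimg_refines. }
        destruct (arc_label_fin HP Hab Hne Hi) as [u [w [Hau [Hbw [_ ->]]]]].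
        destruct (arc_label_fin HP' Hab Hne' Hi') as [u' [w' [Hau' [Hbw' [_ ->]]]]].
        congruence.
Qed.

Hypothesis Hsolid : solid E.

(** Tail and head are recovered by [node_ext]. For inner points some P_X separates the two, and the
    parameter is read off there. *)
Lemma phi_injective x x' : carrierD E x -> carrierD E x' ->
  (forall X, fin_set X -> phi E (comp_part E X) x = phi E (comp_part E X) x') -> x = x'.
Proof.
  intros Hx Hx' H.
  destruct (carrierD_valid Hx) as [Ha Hb]. destruct (carrierD_valid Hx') as [Ha' Hb'].
  assert (Ht : tail_node x = tail_node x').
  { apply (node_ext Hsolid Ha Ha'). intros X HX. rewrite <- !src_phi. now rewrite H. }
  assert (Hh : head_node x = head_node x').
  { apply (node_ext Hsolid Hb Hb'). intros X HX. rewrite <- !tgt_phi. now rewrite H. }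
  (* Arcs join distinct nodes, so the inner points are exactly the points whose tail and head
     differ. *)
  assert (Hne : forall y, carrierD E y -> tail_node y = head_node y <->
    match y with DI _ _ _ => False | _ => True end).
  { intros [v|Om|a b t] Hy; simpl in *; try tauto.
    destruct Hy as [Hab _]. destruct (arc_valid Hab) as [_ [_ Hn]]. tauto. }
  pose proof (Hne x Hx) as Hnx. pose proof (Hne x' Hx') as Hnx'.
  rewrite Ht, Hh in Hnx. rewrite Hnx in Hnx'.
  destruct x as [v|Om|a b t], x' as [v'|Om'|a' b' t']; simpl in *; try tauto; try congruence.
  subst a' b'. f_equal.
  destruct (arc_valid (proj1 Hx)) as [_ [_ Hab]].
  assert (HX : exists X, fin_set X /\ nodeimg (comp_part E X) a <> nodeimg (comp_part E X) b).
  { apply NNPP. intro Hc. apply Hab. apply (node_ext Hsolid Ha Hb). intros X HX.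
    apply NNPP. intro Hn. apply Hc. now exists X. }
  destruct HX as [X [HX Hn]]. specialize (H X HX).
  change (phi E (comp_part E X) (DI a b t) = phi E (comp_part E X) (DI a b t')) in H.
  rewrite !phi_inner_neq in H by exact Hn. congruence.
Qed.

(** * Points of the limit and surjectivity *)

Section LimitPoint.
Variable y : Part E -> qpt V.
Hypothesis Hy : LimS y.

Definition comp_Part X (HX : fin_set X) : Part E :=
  exist _ (comp_part E X) (comp_part_admissible Hsolid HX).

(* Junk when [X] is infinite. *)
Definition coord X : qpt V :=
  match excluded_middle_informative (fin_set X) with
  | left HX => y (comp_Part HX)
  | right _ => QN X
  end.

Lemma coord_carrier X : fin_set X -> carrierQ E (comp_part E X) (coord X).
Proof.
  intro HX. unfold coord. destruct excluded_middle_informative as [H|H]; [|tauto].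
  exact (proj1 Hy (comp_Part H)).
Qed.

Lemma coord_project (P : Part E) X : fin_set X -> refines (proj1_sig P) (comp_part E X) ->
  fmap E (proj1_sig P) (coord X) = y P.
Proof.
  intros HX Href. unfold coord. destruct excluded_middle_informative as [H|H]; [|tauto].
  exact (proj2 Hy P (comp_Part H) Href).
Qed.

Lemma coord_fmap X Y : fin_set X -> fin_set Y -> (forall v, X v -> Y v) ->
  fmap E (comp_part E X) (coord Y) = coord X.
Proof.
  intros HX HY H. unfold coord at 2.
  destruct excluded_middle_informative as [HX'|HX']; [|tauto].
  apply (coord_project (P := comp_Part HX') HY). exact (comp_part_refines Hsolid HX H).
Qed.

(** Bonding maps send sources to sources and targets to targets, so both families of classes shrink
    as [X] grows, and [node_family] applies to each. *)
Lemma coord_nodes : exists a b, valid E a /\ valid E b /\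
  forall X, fin_set X -> src (coord X) = nodeimg (comp_part E X) a /\
    tgt (coord X) = nodeimg (comp_part E X) b.
Proof.
  assert (Hends : forall X, fin_set X ->
    comp_part E X (src (coord X)) /\ comp_part E X (tgt (coord X))).
  { intros X HX. apply carrierQ_ends. now apply coord_carrier. }
  destruct (@node_family V E Hsolid (fun X => src (coord X))) as [a [Ha Hsrc]].
  { intros X HX. now apply Hends. }
  { intros X Y HX HY HXY v Hv. rewrite <- (coord_fmap HX HY HXY), src_fmap.
    apply (cover_refines (comp_part_admissible Hsolid HX) (comp_part_admissible Hsolid HY)); auto.
    - now apply comp_part_refines.
    - now apply Hends. }
  destruct (@node_family V E Hsolid (fun X => tgt (coord X))) as [b [Hb Htgt]].
  { intros X HX. now apply Hends. }
  { intros X Y HX HY HXY v Hv. rewrite <- (coord_fmap HX HY HXY), tgt_fmap.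
    apply (cover_refines (comp_part_admissible Hsolid HX) (comp_part_admissible Hsolid HY)); auto.
    - now apply comp_part_refines.
    - now apply Hends. }
  exists a, b. repeat split; auto; symmetry; auto.
Qed.

(** Every [P] is refined by some P_X with [X] containing [X0], and [y P] is the image of that
    coordinate under the bonding map. *)
Lemma coord_determines x X0 : carrierD E x -> fin_set X0 ->
  (forall X, fin_set X -> (forall v, X0 v -> X v) -> phi E (comp_part E X) x = coord X) ->
  Phi x = y.
Proof.
  intros Hx HX0 H. apply functional_extensionality. intro P. unfold Phi.
  destruct (resolving_set (proj2_sig P)) as [X1 [HX1 Hr]].
  pose (X := fun v => X0 v \/ X1 v).
  assert (HX : fin_set X) by now apply fin_union.
  assert (Href : refines (proj1_sig P) (comp_part E X)).
  { apply (resolves_refines (proj2_sig P)). apply resolves_mono with X1; auto. now right. }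
  rewrite <- (coord_project HX Href), <- (H X HX) by (now left). symmetry.
  apply phi_fmap; auto using comp_part_admissible. exact (proj2_sig P).
Qed.

(* If the coordinates are eventually inner points of edges, this determines an inner point of an
   edge of [D] when some label is an edge, and of a limit edge otherwise. *)
Lemma lim_inner a b X0 l0 p0 q0 t : valid E a -> valid E b ->
  (forall X, fin_set X -> src (coord X) = nodeimg (comp_part E X) a /\
    tgt (coord X) = nodeimg (comp_part E X) b) ->
  fin_set X0 -> coord X0 = QE l0 p0 q0 t -> exists x, carrierD E x /\ Phi x = y.
Proof.
  intros Ha Hb Hnodes HX0 H0.
  (* Bonding maps send nodes to nodes and keep parameters, so beyond [X0] every coordinate is an
     inner point with the same [t]. *)
  assert (H1 : forall X, fin_set X -> (forall v, X0 v -> X v) -> exists l,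
    coord X = QE l (nodeimg (comp_part E X) a) (nodeimg (comp_part E X) b) t /\
    qedge E (comp_part E X) l (nodeimg (comp_part E X) a) (nodeimg (comp_part E X) b) /\
    0 < t < 1).
  { intros X HX Hsub. pose proof (coord_fmap HX0 HX Hsub) as Hc.
    pose proof (coord_carrier HX) as Hcar.
    destruct (Hnodes X HX) as [Hs Ht].
    rewrite H0 in Hc. destruct (coord X) as [p|l p q t']; [discriminate|].
    simpl in Hs, Ht, Hc, Hcar. subst p q. destruct excluded_middle_informative; [discriminate|].
    injection Hc as _ _ _ ->. exists l. auto. }
  (* After [u] and [w] are added to [X] the label is still [(u, w)], and now both ends of the edge
     are singleton classes. *)
  assert (H2 : forall X u w p q, fin_set X -> (forall v, X0 v -> X v) ->
    coord X = QE (Some (u, w)) p q t -> a = inl u /\ b = inl w /\ E u w).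
  { intros X u w p q HX Hsub HcX.
    pose (Y := fun v => (X v \/ v = u) \/ v = w).
    assert (HY : fin_set Y) by (do 2 apply fin_add; exact HX).
    assert (HXY : forall v, X v -> Y v) by (intros v Hv; left; now left).
    destruct (H1 Y HY) as [l [HcY [Hq _]]]; [auto|].
    pose proof (coord_fmap HX HY HXY) as Hc. rewrite HcX, HcY in Hc. simpl in Hc.
    destruct excluded_middle_informative; [discriminate|].
    destruct excluded_middle_informative; [discriminate|].
    injection Hc as -> _ _. destruct Hq as [Hp [Hq [_ [Huw [Hu [Hw _]]]]]].
    assert (HYu : Y u) by (left; now right). assert (HYw : Y w) by now right.
    pose proof (comp_part_admissible Hsolid HY) as HaY.
    split; [|split; [|exact Huw]].
    - apply (nodeimg_singleton Hsolid HY HYu Ha).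
      apply (class_eq (v := u) HaY); auto. left. now exists u.
    - apply (nodeimg_singleton Hsolid HY HYw Hb).
      apply (class_eq (v := w) HaY); auto. left. now exists w. }
  assert (Harc : arc E a b).
  { destruct (classic (exists X u w p q, fin_set X /\ (forall v, X0 v -> X v) /\
      coord X = QE (Some (u, w)) p q t)) as [[X [u [w [p [q [HX [Hsub Hc]]]]]]]|Hn].
    { left. exists u, w. eapply H2; eauto. }
    (* No label is an edge, so beyond [X0] all coordinates lie on quotient edges. *)
    assert (Hinf : forall X, fin_set X -> (forall v, X0 v -> X v) ->
      nodeimg (comp_part E X) a <> nodeimg (comp_part E X) b /\
      inf_edges E (nodeimg (comp_part E X) a) (nodeimg (comp_part E X) b)).
    { intros X HX Hsub. destruct (H1 X HX Hsub) as [[[u w]|] [Hc [[_ [_ [Hne Hq]]] _]]].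
      - destruct Hn. exists X, u, w. eexists. eexists. eauto.
      - auto. }
    right. destruct a as [v|Om], b as [w|Eta].
    (* Two vertices are impossible: with both in [Y] their classes are singletons, and at most one
       edge joins them. *)
    - pose (Y := fun z => (X0 z \/ z = v) \/ z = w).
      assert (HY : fin_set Y) by (do 2 apply fin_add; exact HX0).
      destruct (Hinf Y HY) as [_ Hi]; [intros z Hz; left; now left|].
      simpl in Hi. rewrite !comp_part_vertex in Hi; auto; [|now right|left; now right].
      apply Hi. exists [(v, w)]. intros [v' w'] [_ [Hv Hw]]. simpl in Hv, Hw. subst. now left.
    - split; [exact Hb|]. intros X HX Hv.
      (* Enlarging [X] makes [v] a class of its own and reaches the quotient edges; an edge found
         there leads into the smaller component [CX E Y Eta], hence into [CX E X Eta]. *)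
      pose (Y := fun z => (X z \/ X0 z) \/ z = v).
      assert (HY : fin_set Y) by (apply fin_add; now apply fin_union).
      destruct (Hinf Y HY) as [_ Hi]; [intros z Hz; left; now right|].
      simpl in Hi. rewrite comp_part_vertex, comp_part_end in Hi; auto; [|now right].
      destruct (inf_edges_inhabited Hi) as [v' [u [He [Hv' Hu]]]]. subst v'. exists u.
      split; [exact He|].
      revert Hu. apply end_component_mono; auto. intros z Hz. left; now left.
    - split; [exact Ha|]. intros X HX Hv.
      pose (Y := fun z => (X z \/ X0 z) \/ z = w).
      assert (HY : fin_set Y) by (apply fin_add; now apply fin_union).
      destruct (Hinf Y HY) as [_ Hi]; [intros z Hz; left; now right|].
      simpl in Hi. rewrite comp_part_vertex, comp_part_end in Hi; auto; [|now right].
      destruct (inf_edges_inhabited Hi) as [u [w' [He [Hu Hw']]]]. subst w'. exists u.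
      split; [exact He|].
      revert Hu. apply end_component_mono; auto. intros z Hz. left; now left.
    - split; [exact Ha|]. split; [exact Hb|]. split.
      + intro Hsame. destruct (Hinf X0 HX0) as [Hne _]; [auto|]. apply Hne.
        f_equal. f_equal. now apply set_ext.
      + intros X HX _. pose (Y := fun z => X z \/ X0 z).
        assert (HY : fin_set Y) by now apply fin_union.
        destruct (Hinf Y HY) as [_ Hi]; [now right|].
        simpl in Hi. rewrite !comp_part_end in Hi; auto.
        destruct (inf_edges_inhabited Hi) as [u [w [He [Hu Hw]]]]. exists u, w.
        split; [exact He|].
        split; [revert Hu|revert Hw]; apply end_component_mono; auto; now left. }
  exists (DI a b t).
  assert (Hcar : carrierD E (DI a b t)).
  { split; [exact Harc|]. destruct (H1 X0 HX0) as [_ [_ [_ Ht]]]; auto. }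
  split; [exact Hcar|]. apply (coord_determines Hcar HX0). intros X HX Hsub.
  destruct (H1 X HX Hsub) as [l [Hc [[_ [_ [Hne Hq]]] _]]].
  rewrite (phi_inner_neq t Hne), Hc. f_equal. destruct l as [[u w]|].
  - destruct (H2 _ _ _ _ _ HX Hsub Hc) as [Hau [Hbw _]].
    destruct Hq as [_ [_ [_ Hfin]]].
    destruct (arc_label_fin (comp_part_admissible Hsolid HX) Harc Hne Hfin)
      as [u' [w' [Hau' [Hbw' [_ ->]]]]]. congruence.
  - now apply arc_label_inf.
Qed.

Lemma lim_point : exists x, carrierD E x /\ Phi x = y.
Proof.
  destruct coord_nodes as [a [b [Ha [Hb Hnodes]]]].
  destruct (classic (exists X l p q t, fin_set X /\ coord X = QE l p q t))
    as [[X0 [l0 [p0 [q0 [t [HX0 H0]]]]]]|Hn].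
  - exact (lim_inner Ha Hb Hnodes HX0 H0).
  (* All coordinates are nodes, so the sources alone give the point. *)
  - pose (x := match a with inl v => DV v | inr Om => DE Om end).
    assert (Hx : carrierD E x) by (destruct a; exact Ha).
    exists x. split; [exact Hx|].
    apply (coord_determines Hx (fin_list [])). intros X HX _.
    destruct (Hnodes X HX) as [Hs _].
    destruct (coord X) as [p|l p q t] eqn:Hc.
    + simpl in Hs. subst p. destruct a; reflexivity.
    + destruct Hn. exists X, l, p, q, t. auto.
Qed.

End LimitPoint.
End Projections.

(** * The topologies *)

(** Continuity needs to be checked only on subbasic sets, since basic neighbourhoods are finite
    intersections of these. *)
Lemma generated_preimage {T1 T2 : Type} (S1 : T1 -> Prop) B1 (S2 : T2 -> Prop) B2
  (f : T1 -> T2) : (forall x, S1 x -> S2 (f x)) ->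
  (forall x b, S1 x -> B2 b -> b (f x) ->
    exists c, B1 c /\ c x /\ forall x', S1 x' -> c x' -> b (f x')) ->
  forall U, generated S2 B2 U -> generated S1 B1 (fun x => S1 x /\ U (f x)).
Proof.
  intros HS HB U [_ HU]. split; [tauto|]. intros x [Hx HUx].
  destruct (HU _ HUx) as [l [Hl [_ [Hlx Hsub]]]].
  assert (H : exists l', (forall c, In c l' -> B1 c) /\ (forall c, In c l' -> c x) /\
    forall x', S1 x' -> (forall c, In c l' -> c x') -> forall b, In b l -> b (f x')).
  { clear Hsub. induction l as [|b l IH].
    - exists []. simpl. tauto.
    - destruct IH as [l' [H1 [H2 H3]]];
        [intros b' Hb'; apply Hl; now right|intros b' Hb'; apply Hlx; now right|].
      destruct (HB x b Hx) as [c [Hc1 [Hc2 Hc3]]]; [apply Hl; now left|apply Hlx; now left|].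
      exists (c :: l'). split; [intros c' [<-|Hc']; auto|].
      split; [intros c' [<-|Hc']; [exact Hc2|now apply H2]|].
      intros x' Hx' Hall b' [<-|Hb'].
      + apply Hc3; [exact Hx'|]. apply Hall. now left.
      + apply (H3 x' Hx'); [|exact Hb']. intros c' Hc'. apply Hall. now right. }
  destruct H as [l' [H1 [H2 H3]]]. exists l'.
  split; [exact H1|]. split; [exact Hx|]. split; [exact H2|].
  intros x' Hx' Hall. split; [exact Hx'|]. apply Hsub; [now apply HS|].
  now apply H3.
Qed.

Section Topology.
Context {V : Type} (E : V -> V -> Prop).
Implicit Types (X Y p q : V -> Prop) (u v : V) (Om Eta : (nat -> V) -> Prop)
  (P : (V -> Prop) -> Prop) (a b : node V) (x : dpt V).

Definition star_nbhd P p (eps : R) (z : qpt V) : Prop :=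
  match z with
  | QN q => P q /\ q = p
  | QE l p1 p2 t => qedge E P l p1 p2 /\ 0 < t < 1 /\
      ((p1 = p /\ t < eps) \/ (p2 = p /\ 1 - eps < t))
  end.

(** No label is fixed, so that the same set serves copies of edges and quotient edges. *)
Definition band_nbhd P p q (s1 s2 : R) (z : qpt V) : Prop :=
  match z with
  | QN _ => False
  | QE l p1 p2 t => qedge E P l p1 p2 /\ 0 < t < 1 /\ p1 = p /\ p2 = q /\ s1 < t < s2
  end.

Lemma ept_0 (l : option (V * V)) p q : ept l p q 0 = QN p.
Proof. unfold ept. destruct Req_EM_T; [reflexivity|lra]. Qed.

Lemma ept_1 (l : option (V * V)) p q : ept l p q 1 = QN q.
Proof.
  unfold ept. destruct Req_EM_T; [lra|]. destruct Req_EM_T; [reflexivity|lra].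
Qed.

Lemma ept_inner (l : option (V * V)) p q t : 0 < t < 1 -> ept l p q t = QE l p q t.
Proof.
  intro H. unfold ept. destruct Req_EM_T; [lra|]. destruct Req_EM_T; [lra|reflexivity].
Qed.

Lemma unit_cases t : 0 <= t <= 1 -> t = 0 \/ t = 1 \/ 0 < t < 1.
Proof. lra. Qed.

Lemma Rmin3_spec r1 r2 r3 : 0 < r1 -> 0 < r2 -> 0 < r3 ->
  exists d, 0 < d /\ d <= r1 /\ d <= r2 /\ d <= r3.
Proof.
  intros H1 H2 H3. exists (Rmin r1 (Rmin r2 r3)).
  pose proof (Rmin_l r1 (Rmin r2 r3)). pose proof (Rmin_r r1 (Rmin r2 r3)).
  pose proof (Rmin_l r2 r3). pose proof (Rmin_r r2 r3).
  repeat split; try lra. repeat apply Rmin_glb_lt; auto.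
Qed.

Lemma star_nbhd_open P p eps : 0 < eps < 1 -> cx_open E P (star_nbhd P p eps).
Proof.
  intro He. split.
  - intros [q|l p1 p2 t]; simpl; tauto.
  - intros l p1 p2 Hq t Ht. pose proof Hq as [Hp1 [Hp2 _]].
    destruct (unit_cases Ht) as [->|[->|Ht']].
    + rewrite ept_0. intros [_ ->]. exists eps. split; [lra|]. intros s Hs Hd.
      apply Rabs_def2 in Hd. destruct (unit_cases Hs) as [->|[->|Hs']].
      * rewrite ept_0. simpl. auto.
      * lra.
      * rewrite ept_inner by exact Hs'. simpl. repeat split; try apply Hs'; try apply Hq.
        left. split; [reflexivity|lra].
    + rewrite ept_1. intros [_ ->]. exists eps. split; [lra|]. intros s Hs Hd.
      apply Rabs_def2 in Hd. destruct (unit_cases Hs) as [->|[->|Hs']].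
      * lra.
      * rewrite ept_1. simpl. auto.
      * rewrite ept_inner by exact Hs'. simpl. repeat split; try apply Hs'; try apply Hq.
        right. split; [reflexivity|lra].
    + rewrite ept_inner by exact Ht'. intros [_ [_ [[-> Hlt]|[-> Hlt]]]].
      * destruct (@Rmin3_spec t (1 - t) (eps - t)) as [d Hd]; try lra.
        exists d. split; [lra|]. intros s Hs Hsd. apply Rabs_def2 in Hsd.
        rewrite ept_inner by lra. split; [exact Hq|]. split; [lra|]. left.
        split; [reflexivity|lra].
      * destruct (@Rmin3_spec t (1 - t) (t - (1 - eps))) as [d Hd]; try lra.
        exists d. split; [lra|]. intros s Hs Hsd. apply Rabs_def2 in Hsd.
        rewrite ept_inner by lra. split; [exact Hq|]. split; [lra|]. right.
        split; [reflexivity|lra].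
Qed.

Lemma band_nbhd_open P p q s1 s2 : cx_open E P (band_nbhd P p q s1 s2).
Proof.
  split.
  - intros [q'|l p1 p2 t]; simpl; tauto.
  - intros l p1 p2 Hq t Ht.
    destruct (unit_cases Ht) as [->|[->|Ht']].
    + rewrite ept_0. intros [].
    + rewrite ept_1. intros [].
    + rewrite ept_inner by exact Ht'. intros [_ [_ [-> [-> Hs]]]].
      destruct (@Rmin3_spec t (1 - t) (t - s1)) as [d Hd]; try lra.
      destruct (@Rmin3_spec d d (s2 - t)) as [d' Hd']; try lra.
      exists d'. split; [lra|]. intros s Hs' Hsd. apply Rabs_def2 in Hsd.
      rewrite ept_inner by lra. split; [exact Hq|]. repeat split; lra.
Qed.

(** Between two of the finitely many classes there is either just the quotient edge or one copy for
    each of finitely many edges. *)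
Lemma qedge_fin P : admissible E P ->
  fin_set (fun e : option (V * V) * ((V -> Prop) * (V -> Prop)) =>
    qedge E P (fst e) (fst (snd e)) (snd (snd e))).
Proof.
  intros [HP _].
  assert (H : exists A, fin_set A /\ forall p, P p -> forall q, P q ->
    forall l, qedge E P l p q -> A l).
  { apply (fin_unif (Q := fun p A => forall q, P q -> forall l, qedge E P l p q -> A l) HP).
    { intros p A A' _ H HAA' q Hq l Hl. apply HAA'. exact (H q Hq l Hl). }
    intros p Hp.
    apply (fin_unif (Q := fun q A => forall l, qedge E P l p q -> A l) HP).
    { intros q A A' _ H HAA' l Hl. apply HAA'. exact (H l Hl). }
    intros q Hq.
    destruct (classic (inf_edges E p q)) as [Hi|Hi].
    - exists (eq None). split; [exists [None]; intros ? <-; now left|].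
      intros [[u w]|] [_ [_ [_ Hl]]]; [tauto|reflexivity].
    - apply NNPP in Hi. destruct Hi as [m Hm].
      exists (fun l => In l (map Some m)). split; [apply fin_list|].
      intros [[u w]|] [_ [_ [_ Hl]]].
      + apply in_map. apply Hm. simpl. tauto.
      + destruct Hl. now exists m. }
  destruct H as [A [[m Hm] HA]]. destruct HP as [lP HlP].
  exists (list_prod m (list_prod lP lP)). intros [l [p q]] Hq. simpl in Hq.
  pose proof Hq as [Hp1 [Hp2 _]].
  apply in_prod; [apply Hm; eauto|apply in_prod; auto].
Qed.

(** D/P has finitely many edges, so the radii available on those leaving or entering [p] have a
    common positive lower bound. *)
Lemma star_nbhd_basis P p W : admissible E P -> cx_open E P W -> W (QN p) ->
  exists eps, 0 < eps < 1 /\ forall z, star_nbhd P p eps z -> W z.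
Proof.
  intros HP [_ HW] Hp.
  destruct (fin_unif_eps (Q := fun e d =>
    (fst (snd e) = p -> forall t, 0 < t < 1 -> t < d -> W (QE (fst e) (fst (snd e)) (snd (snd e)) t)) /\
    (snd (snd e) = p -> forall t, 0 < t < 1 -> 1 - d < t ->
      W (QE (fst e) (fst (snd e)) (snd (snd e)) t))) (qedge_fin HP)) as [eps [Heps H]].
  - intros s d d' _ [H1 H2] Hd. split; intros Hs t Ht Htd; [apply H1|apply H2]; auto; lra.
  - intros [l [p1 p2]] Hq. simpl in Hq |- *.
    assert (H1 : exists d, 0 < d /\ (p1 = p -> forall t, 0 < t < 1 -> t < d -> W (QE l p1 p2 t))).
    { destruct (classic (p1 = p)) as [->|Hne]; [|exists 1; split; [lra|tauto]].
      destruct (HW l p p2 Hq 0) as [d [Hd H]]; [lra|now rewrite ept_0|].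
      exists d. split; [exact Hd|]. intros _ t Ht Htd. rewrite <- ept_inner by exact Ht.
      apply H; [lra|]. apply Rabs_def1; lra. }
    assert (H2 : exists d, 0 < d /\ (p2 = p -> forall t, 0 < t < 1 -> 1 - d < t -> W (QE l p1 p2 t))).
    { destruct (classic (p2 = p)) as [->|Hne]; [|exists 1; split; [lra|tauto]].
      destruct (HW l p1 p Hq 1) as [d [Hd H]]; [lra|now rewrite ept_1|].
      exists d. split; [exact Hd|]. intros _ t Ht Htd. rewrite <- ept_inner by exact Ht.
      apply H; [lra|]. apply Rabs_def1; lra. }
    destruct H1 as [d1 [Hd1 H1]], H2 as [d2 [Hd2 H2]].
    destruct (@Rmin3_spec d1 d2 d2) as [d Hd]; auto.
    exists d. split; [lra|].
    split; intros Hs t Ht Htd; [apply H1|apply H2]; auto; lra.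
  - exists eps. split; [exact Heps|]. intros [q|l p1 p2 t]; simpl.
    + intros [_ ->]. exact Hp.
    + intros [Hq [Ht Hcase]]. destruct (H (l, (p1, p2)) Hq) as [H1 H2]. simpl in H1, H2.
      destruct Hcase as [[Hp1 Hlt]|[Hp2 Hlt]]; auto.
Qed.

Hypothesis Hloop : forall v, ~ E v v.

(** The common shape of the stars at vertices, where [M] is one node, and of the sets [Chat], where
    [M] consists of the nodes of a component. *)
Definition star_around (M : node V -> Prop) (eps : R) x : Prop :=
  match x with
  | DV v => M (inl v)
  | DE Om => M (inr Om)
  | DI a b t => (M a /\ M b) \/ (M a /\ ~ M b /\ t < eps) \/ (~ M a /\ M b /\ 1 - eps < t)
  end.

Lemma star_nbhd_phi P p M eps x : admissible E P -> P p ->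
  (forall a, valid E a -> M a -> nodeimg P a = p) ->
  carrierD E x -> star_around M eps x -> star_nbhd P p eps (phi E P x).
Proof.
  intros HP Hp HM Hx Hs. destruct x as [v|Om|a b t].
  - pose proof (HM (inl v) I Hs) as H. simpl in *. now rewrite H.
  - pose proof (HM (inr Om) Hx Hs) as H. simpl in *. now rewrite H.
  - destruct Hx as [Hab Ht]. destruct (arc_valid Hloop Hab) as [Ha [Hb _]].
    destruct (classic (nodeimg P a = nodeimg P b)) as [Heq|Hne].
    + rewrite phi_inner_eq by exact Heq. destruct Hs as [[Hs _]|[[Hs _]|[_ [Hs _]]]].
      * rewrite (HM a Ha Hs). now split.
      * rewrite (HM a Ha Hs). now split.
      * rewrite Heq, (HM b Hb Hs). now split.
    + rewrite phi_inner_neq by exact Hne. split; [now apply arc_qedge|]. split; [exact Ht|].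
      destruct Hs as [[Hs Hs']|[[Hs [_ Hlt]]|[_ [Hs Hlt]]]].
      * destruct Hne. now rewrite (HM a Ha Hs), (HM b Hb Hs').
      * left. auto.
      * right. auto.
Qed.

Lemma star_nbhd_phi_iff P p M eps x : admissible E P -> P p ->
  (forall a, valid E a -> (nodeimg P a = p <-> M a)) ->
  carrierD E x -> (star_nbhd P p eps (phi E P x) <-> star_around M eps x).
Proof.
  intros HP Hp HM Hx. split; [|apply star_nbhd_phi; auto; intros a Ha; now apply HM].
  destruct x as [v|Om|a b t].
  - intros [_ H]. now apply (HM (inl v) I).
  - intros [_ H]. now apply (HM (inr Om) Hx).
  - destruct Hx as [Hab Ht]. destruct (arc_valid Hloop Hab) as [Ha [Hb _]].
    destruct (classic (nodeimg P a = nodeimg P b)) as [Heq|Hne].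
    + rewrite phi_inner_eq by exact Heq. intros [_ H]. left.
      split; [now apply HM|]. apply HM; congruence.
    + rewrite phi_inner_neq by exact Hne. intros [_ [_ [[H Hlt]|[H Hlt]]]]; right; [left|right].
      * split; [now apply HM|]. split; [|exact Hlt]. intro Hc. apply Hne.
        apply HM in Hc; congruence.
      * split; [|split; [now apply HM|exact Hlt]]. intro Hc. apply Hne.
        apply HM in Hc; congruence.
Qed.

(** As [p] and [q] differ, an arc from [M] to [N] is not collapsed, and its inner points keep their
    parameter. *)
Lemma band_nbhd_phi_iff P p q (M N : node V -> Prop) s1 s2 x : admissible E P -> p <> q ->
  (forall a, valid E a -> (nodeimg P a = p <-> M a)) ->
  (forall a, valid E a -> (nodeimg P a = q <-> N a)) ->
  carrierD E x ->
  (band_nbhd P p q s1 s2 (phi E P x) <->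
   match x with DI a b t => M a /\ N b /\ s1 < t < s2 | _ => False end).
Proof.
  intros HP Hpq HM HN Hx. destruct x as [v|Om|a b t]; [reflexivity|reflexivity|].
  destruct Hx as [Hab Ht]. destruct (arc_valid Hloop Hab) as [Ha [Hb _]].
  rewrite <- (HM a Ha), <- (HN b Hb).
  destruct (classic (nodeimg P a = nodeimg P b)) as [Heq|Hne].
  - rewrite phi_inner_eq by exact Heq. simpl. split; [tauto|]. intros [H1 [H2 _]]. congruence.
  - rewrite phi_inner_neq by exact Hne. simpl.
    pose proof (arc_qedge Hloop HP Hab Hne). tauto.
Qed.

Hypothesis Hsolid : solid E.

Lemma star_around_vertex v eps x : carrierD E x ->
  (star E v eps x <-> star_around (fun a => a = inl v) eps x).
Proof.
  intro Hx. unfold star. destruct x as [w|Om|a b t]; simpl.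
  - split; [|intro H; left; congruence].
    intros [H|[[b [t [H _]]]|[a [t [H _]]]]]; congruence.
  - split; [|discriminate].
    intros [H|[[b [t [H _]]]|[a [t [H _]]]]]; congruence.
  - destruct Hx as [Hab Ht]. destruct (arc_valid Hloop Hab) as [_ [_ Hne]]. split.
    + intros [H|[[b' [t' [H [_ Hlt]]]]|[a' [t' [H [_ Hlt]]]]]]; [discriminate| |];
        injection H as -> -> ->; right; [left|right]; repeat split; auto; lra.
    + intros [[-> ->]|[[-> [_ Hlt]]|[_ [-> Hlt]]]]; [tauto| |]; right; [left|right].
      * exists b, t. repeat split; auto; lra.
      * exists a, t. repeat split; auto; lra.
Qed.

Lemma star_around_end X Om eps x : carrierD E x ->
  (Chat E X Om eps x <-> star_around (inComp (CX E X Om)) eps x).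
Proof. destruct x as [w|Eta|a b t]; simpl; intro Hx; tauto. Qed.

Lemma Rabs_band t z eps : Rabs (t - z) < eps <-> z - eps < t < z + eps.
Proof.
  split; intro H; [apply Rabs_def2 in H|apply Rabs_def1]; lra.
Qed.

(** [X] consists of the vertex for a star, of both ends for an edge, and is the given set otherwise.
    Vertices of [X] and strong components of D - X are classes of P_X, so the sets are preimages of
    stars and bands. *)
Lemma subbase_preimage B : subbaseD E B ->
  exists X W, fin_set X /\ cx_open E (comp_part E X) W /\
    forall x, carrierD E x -> (W (phi E (comp_part E X) x) <-> B x).
Proof.
  intros [HB|[HB|[HB|[HB|[HB|HB]]]]].
  - destruct HB as [v [eps [He ->]]].
    assert (HX : fin_set (eq v)) by (exists [v]; intros ? <-; now left).
    exists (eq v), (star_nbhd (comp_part E (eq v)) (eq v) eps).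
    split; [exact HX|]. split; [now apply star_nbhd_open|].
    intros x Hx. rewrite star_around_vertex by exact Hx.
    apply star_nbhd_phi_iff; auto using comp_part_admissible.
    + left. exists v. auto.
    + intros a Ha. now apply nodeimg_singleton.
  - destruct HB as [u [w [s1 [s2 [Huw [H1 [H2 [H3 ->]]]]]]]].
    pose (X := fun v => v = u \/ v = w).
    assert (HX : fin_set X) by (exists [u; w]; intros v [-> | ->]; simpl; auto).
    assert (HXu : X u) by now left. assert (HXw : X w) by now right.
    exists X, (band_nbhd (comp_part E X) (eq u) (eq w) s1 s2).
    split; [exact HX|]. split; [apply band_nbhd_open|].
    intros x Hx.
    rewrite (@band_nbhd_phi_iff _ _ _ (fun a => a = inl u) (fun a => a = inl w));
      auto using comp_part_admissible.
    + unfold edge_int. destruct x as [v|Om|a b t].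
      * split; [tauto|]. intros [t [H _]]. discriminate.
      * split; [tauto|]. intros [t [H _]]. discriminate.
      * split.
        -- intros [-> [-> Ht]]. now exists t.
        -- intros [t' [H Ht]]. injection H as -> -> ->. auto.
    + intro H. assert (Hwu : eq u w) by now rewrite H. subst w. exact (Hloop Huw).
    + intros a Ha. now apply nodeimg_singleton.
    + intros a Ha. now apply nodeimg_singleton.
  - destruct HB as [X [Om [eps [HX [HOm [He ->]]]]]].
    exists X, (star_nbhd (comp_part E X) (CX E X Om) eps).
    split; [exact HX|]. split; [now apply star_nbhd_open|].
    intros x Hx. rewrite star_around_end by exact Hx.
    apply star_nbhd_phi_iff; auto using comp_part_admissible.
    + right. now apply end_component.
    + intros a Ha. now apply nodeimg_comp_part.
  - destruct HB as [Om [Eta [z [X [eps [Hl [Hz [HX [Hsep [He ->]]]]]]]]]].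
    destruct Hl as [HOm [HEta _]].
    exists X, (band_nbhd (comp_part E X) (CX E X Om) (CX E X Eta) (z - eps) (z + eps)).
    split; [exact HX|]. split; [apply band_nbhd_open|].
    intros x Hx.
    rewrite (@band_nbhd_phi_iff _ _ _ (inComp (CX E X Om)) (inComp (CX E X Eta)));
      auto using comp_part_admissible.
    + unfold lim_nbhs_ee. destruct x as [v|Om'|a b t].
      * split; [tauto|]. intros [a [b [t [H _]]]]. discriminate.
      * split; [tauto|]. intros [a [b [t [H _]]]]. discriminate.
      * rewrite <- Rabs_band. split.
        -- intros [Ha [Hb Ht]]. exists a, b, t. destruct Hx. auto.
        -- intros [a' [b' [t' [H [_ [Ha [Hb Ht]]]]]]]. injection H as -> -> ->. auto.
    + now apply sepE_neq.
    + intros a Ha. now apply nodeimg_comp_part.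
    + intros a Ha. now apply nodeimg_comp_part.
  - destruct HB as [v [Om [z [X [eps [Hl [Hz [HX [Hv [He ->]]]]]]]]]].
    destruct Hl as [HOm _].
    exists X, (band_nbhd (comp_part E X) (eq v) (CX E X Om) (z - eps) (z + eps)).
    split; [exact HX|]. split; [apply band_nbhd_open|].
    intros x Hx.
    rewrite (@band_nbhd_phi_iff _ _ _ (fun a => a = inl v) (inComp (CX E X Om)));
      auto using comp_part_admissible.
    + unfold lim_nbhs_ve. destruct x as [w|Om'|a b t].
      * split; [tauto|]. intros [b [t [H _]]]. discriminate.
      * split; [tauto|]. intros [b [t [H _]]]. discriminate.
      * rewrite <- Rabs_band. split.
        -- intros [-> [Hb Ht]]. exists b, t. destruct Hx. auto.
        -- intros [b' [t' [H [_ [Hb Ht]]]]]. injection H as -> -> ->. auto.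
    + intro H. apply (is_scomp_notin (v := v) (proj1 (end_component HOm HX))); [|exact Hv].
      now rewrite <- H.
    + intros a Ha. now apply nodeimg_singleton.
    + intros a Ha. now apply nodeimg_comp_part.
  - destruct HB as [v [Om [z [X [eps [Hl [Hz [HX [Hv [He ->]]]]]]]]]].
    destruct Hl as [HOm _].
    exists X, (band_nbhd (comp_part E X) (CX E X Om) (eq v) (z - eps) (z + eps)).
    split; [exact HX|]. split; [apply band_nbhd_open|].
    intros x Hx.
    rewrite (@band_nbhd_phi_iff _ _ _ (inComp (CX E X Om)) (fun a => a = inl v));
      auto using comp_part_admissible.
    + unfold lim_nbhs_ev. destruct x as [w|Om'|a b t].
      * split; [tauto|]. intros [a [t [H _]]]. discriminate.
      * split; [tauto|]. intros [a [t [H _]]]. discriminate.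
      * rewrite <- Rabs_band. split.
        -- intros [Ha [-> Ht]]. exists a, t. destruct Hx. auto.
        -- intros [a' [t' [H [_ [Ha Ht]]]]]. injection H as -> -> ->. auto.
    + intro H. apply (is_scomp_notin (v := v) (proj1 (end_component HOm HX))); [|exact Hv].
      now rewrite H.
    + intros a Ha. now apply nodeimg_comp_part.
    + intros a Ha. now apply nodeimg_singleton.
Qed.

(** For a limit edge, a set that resolves [P] is enlarged until the subbasic set at the point is
    defined. The arcs in it have ends with the same images as [a] and [b]; if these differ, all run
    over the quotient edge. *)
Lemma inner_nbhd P a b t eps : admissible E P -> arc E a b -> 0 < t < 1 -> 0 < eps ->
  exists B, subbaseD E B /\ B (DI a b t) /\ forall x, carrierD E x -> B x ->
    exists a' b' t', x = DI a' b' t' /\ nodeimg P a' = nodeimg P a /\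
      nodeimg P b' = nodeimg P b /\ Rabs (t' - t) < eps /\
      (nodeimg P a <> nodeimg P b -> arc_label E P a' b' = arc_label E P a b).
Proof.
  intros HP Hab Ht He.
  destruct (resolving_set HP) as [X [HX Hr]].
  assert (Hself : Rabs (t - t) < eps) by (apply Rabs_band; lra).
  destruct Hab as [[u [w [-> [-> Huw]]]]|Hab].
  (* The interval around [t] is clipped to [0,1], as [edge_int] is subbasic only for such bounds. *)
  - pose proof (Rmax_l 0 (t - eps)). pose proof (Rmax_r 0 (t - eps)).
    pose proof (Rmin_l 1 (t + eps)). pose proof (Rmin_r 1 (t + eps)).
    assert (Hmax : Rmax 0 (t - eps) < t) by (apply Rmax_lub_lt; lra).
    assert (Hmin : t < Rmin 1 (t + eps)) by (apply Rmin_glb_lt; lra).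
    exists (edge_int u w (Rmax 0 (t - eps)) (Rmin 1 (t + eps))). split; [|split].
    + right; left. exists u, w, (Rmax 0 (t - eps)), (Rmin 1 (t + eps)).
      repeat split; auto; lra.
    + exists t. auto.
    + intros x _ [t' [-> Ht']]. exists (inl u), (inl w), t'. repeat split.
      apply Rabs_band. lra.
  - assert (Hlab : forall a' b', nodeimg P a' = nodeimg P a -> nodeimg P b' = nodeimg P b ->
      nodeimg P a <> nodeimg P b -> arc_label E P a' b' = arc_label E P a b).
    { intros a' b' Ha Hb Hne. pose proof (limedge_inf HP Hab Hne) as Hi.
      rewrite !arc_label_inf; [reflexivity|exact Hi|now rewrite Ha, Hb]. }
    destruct a as [v|Om], b as [w|Eta]; [destruct Hab| | |].
    + pose (Y := fun u => X u \/ u = v). assert (HY : fin_set Y) by now apply fin_add.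
      assert (HrY : resolves E P Y) by (apply resolves_mono with X; auto; now left).
      pose proof Hab as [HEta _].
      exists (lim_nbhs_ve E v Y Eta t eps). split; [|split].
      * do 4 right; left. exists v, Eta, t, Y, eps.
        split; [exact Hab|]. split; [exact Ht|]. split; [exact HY|].
        split; [now right|]. now split.
      * exists (inr Eta), t. repeat split; auto; [now right|].
        simpl. now apply lives_component.
      * intros x Hx [b' [t' [-> [Harc [Hb Htt]]]]]. exists (inl v), b', t'.
        assert (Hb' : nodeimg P b' = nodeimg P (inr Eta)).
        { apply (nodeimg_inComp HP HY HrY HEta); [|exact Hb]. now apply arc_valid in Harc. }
        repeat split; auto.
    + pose (Y := fun u => X u \/ u = w). assert (HY : fin_set Y) by now apply fin_add.
      assert (HrY : resolves E P Y) by (apply resolves_mono with X; auto; now left).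
      pose proof Hab as [HOm _].
      exists (lim_nbhs_ev E w Y Om t eps). split; [|split].
      * do 5 right. exists w, Om, t, Y, eps.
        split; [exact Hab|]. split; [exact Ht|]. split; [exact HY|].
        split; [now right|]. now split.
      * exists (inr Om), t. repeat split; auto; [now right|].
        simpl. now apply lives_component.
      * intros x Hx [a' [t' [-> [Harc [Ha Htt]]]]]. exists a', (inl w), t'.
        assert (Ha' : nodeimg P a' = nodeimg P (inr Om)).
        { apply (nodeimg_inComp HP HY HrY HOm); [|exact Ha]. now apply arc_valid in Harc. }
        repeat split; auto.
    + pose proof Hab as [HOm [HEta [Hne _]]].
      (* Distinct ends are separated by some finite [Z]; joining it to [X] keeps them separated and
         still resolves [P]. *)
      assert (HZ : exists Z, fin_set Z /\ CX E Z Om <> CX E Z Eta).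
      { apply NNPP. intro Hc. apply Hne. rewrite (end_ext HOm HEta).
        - intro r. reflexivity.
        - intros Z HZ. apply NNPP. intro Hn. apply Hc. now exists Z. }
      destruct HZ as [Z [HZ HZne]].
      pose (Y := fun u => X u \/ Z u). assert (HY : fin_set Y) by now apply fin_union.
      assert (HrY : resolves E P Y) by (apply resolves_mono with X; auto; now left).
      assert (Hsep : sepE E Y Om Eta).
      { apply sepE_neq. intro Hc. apply HZne.
        destruct (end_component HOm HY) as [HC _].
        destruct (is_scomp_nonempty HC) as [u Hu].
        assert (Hu1 : CX E Z Om u)
          by (revert Hu; apply end_component_mono; auto; now right).
        assert (Hu2 : CX E Z Eta u)
          by (rewrite Hc in Hu; revert Hu; apply end_component_mono; auto; now right).
        now rewrite (is_scomp_eq (proj1 (end_component HOm HZ)) Hu1),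
          (is_scomp_eq (proj1 (end_component HEta HZ)) Hu2). }
      exists (lim_nbhs_ee E Y Om Eta t eps). split; [|split].
      * do 3 right; left. exists Om, Eta, t, Y, eps.
        split; [exact Hab|]. split; [exact Ht|]. split; [exact HY|].
        split; [exact Hsep|]. now split.
      * exists (inr Om), (inr Eta), t. repeat split; auto; [now right| |];
          simpl; now apply lives_component.
      * intros x Hx [a' [b' [t' [-> [Harc [Ha [Hb Htt]]]]]]]. exists a', b', t'.
        destruct (arc_valid Hloop Harc) as [Hva [Hvb _]].
        assert (Ha' : nodeimg P a' = nodeimg P (inr Om))
          by exact (nodeimg_inComp HP HY HrY HOm Hva Ha).
        assert (Hb' : nodeimg P b' = nodeimg P (inr Eta))
          by exact (nodeimg_inComp HP HY HrY HEta Hvb Hb).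
        repeat split; auto.
Qed.

Lemma phi_continuous P W x : admissible E P -> cx_open E P W -> carrierD E x ->
  W (phi E P x) ->
  exists B, subbaseD E B /\ B x /\ forall x', carrierD E x' -> B x' -> W (phi E P x').
Proof.
  intros HP HW Hx HWx. destruct x as [v|Om|a b t].
  - destruct (star_nbhd_basis HP HW HWx) as [eps [He Heps]].
    exists (star E v eps). split; [|split].
    + left. exists v, eps. auto.
    + now left.
    + intros x' Hx' Hs. apply Heps. apply (star_around_vertex v eps Hx') in Hs.
      apply star_nbhd_phi with (5 := Hs); auto.
      * exact (nodeimg_class (a := inl v) HP I).
      * intros a _ ->. reflexivity.
  - destruct (star_nbhd_basis HP HW HWx) as [eps [He Heps]].
    destruct (resolving_set HP) as [X [HX Hr]].
    exists (Chat E X Om eps). split; [|split].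
    + right; right; left. exists X, Om, eps. auto.
    + split; [exact Hx|]. now apply lives_component.
    + intros x' Hx' Hs. apply Heps. apply (star_around_end X Om eps Hx') in Hs.
      apply star_nbhd_phi with (5 := Hs); auto.
      * exact (nodeimg_class (a := inr Om) HP Hx).
      * intros a Ha Hin. exact (nodeimg_inComp HP HX Hr Hx Ha Hin).
  - destruct Hx as [Hab Ht].
    destruct (classic (nodeimg P a = nodeimg P b)) as [Heq|Hne].
    + rewrite phi_inner_eq in HWx by exact Heq.
      (* The arc is collapsed to one class, so any radius will do. *)
      destruct (inner_nbhd HP Hab Ht Rlt_0_1) as [B [HB [HBx H]]].
      exists B. split; [exact HB|]. split; [exact HBx|]. intros x' Hx' HBx'.
      destruct (H x' Hx' HBx') as [a' [b' [t' [-> [Ha [Hb _]]]]]].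
      rewrite phi_inner_eq by congruence. now rewrite Ha.
    + rewrite phi_inner_neq in HWx by exact Hne.
      rewrite <- ept_inner in HWx by exact Ht.
      destruct (proj2 HW _ _ _ (arc_qedge Hloop HP Hab Hne) t) as [d [Hd HWd]];
        [lra|exact HWx|].
      destruct (inner_nbhd HP Hab Ht Hd) as [B [HB [HBx H]]].
      exists B. split; [exact HB|]. split; [exact HBx|]. intros x' Hx' HBx'.
      destruct (H x' Hx' HBx') as [a' [b' [t' [-> [Ha [Hb [Htt Hlab]]]]]]].
      rewrite phi_inner_neq by congruence. rewrite Ha, Hb, Hlab by exact Hne.
      destruct Hx' as [_ Ht']. rewrite <- ept_inner by exact Ht'. apply HWd; [lra|exact Htt].
Qed.

End Topology.

(** * The homeomorphism from |D| to the inverse limit *)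

Theorem theorem2 (V : Type) (E : V -> V -> Prop) :
  (forall v, ~ E v v) -> solid E ->
  homeo (@carrierD V E) (@openD V E) (@LimS V E) (@openL V E) (@Phi V E).
Proof.
  intros Hloop Hsolid.
  assert (HPhi : forall x, carrierD E x -> @LimS V E (Phi x)).
  { intros x Hx. split.
    - intro P. exact (phi_carrier Hloop (proj2_sig P) Hx).
    - intros P P' Href. exact (phi_fmap Hloop (proj2_sig P) (proj2_sig P') Href Hx). }
  assert (Hinj : forall x x', carrierD E x -> carrierD E x' ->
    @Phi V E x = Phi x' -> x = x').
  { intros x x' Hx Hx' Heq. apply (phi_injective Hloop Hsolid Hx Hx'). intros X HX.
    exact (f_equal (fun y => y (comp_Part Hsolid HX)) Heq). }
  split; [exact HPhi|].
  destruct (choice (fun (y : Part E -> qpt V) x => LimS y -> carrierD E x /\ Phi x = y))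
    as [g Hg].
  { intro y. destruct (classic (LimS y)) as [Hy|Hy].
    - destruct (lim_point Hloop Hsolid Hy) as [x Hx]. now exists x.
    (* An arbitrary value for families outside the limit, as [g] has to be total. *)
    - exists (DE (fun _ => False)). tauto. }
  assert (HgPhi : forall x, carrierD E x -> g (Phi x) = x).
  { intros x Hx. destruct (Hg (Phi x) (HPhi x Hx)) as [H1 H2]. now apply Hinj. }
  exists g. split; [|split; [exact HgPhi|split; [|split]]].
  - intros y Hy. now apply Hg.
  - intros y Hy. now apply Hg.
  - apply generated_preimage; [exact HPhi|].
    intros x B Hx [P [W [HW ->]]] HWx.
    exact (phi_continuous Hloop (proj2_sig P) HW Hx HWx).
  - apply generated_preimage; [intros y Hy; now apply Hg|].
    intros y B Hy HB HBy.
    destruct (subbase_preimage Hloop Hsolid HB) as [X [W [HX [HW Hiff]]]].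
    (* On the limit, whether [g y'] lies in [B] is read off from the single coordinate at P_X. *)
    assert (Hpre : forall y', LimS y' -> (W (y' (comp_Part Hsolid HX)) <-> B (g y'))).
    { intros y' Hy'. destruct (Hg y' Hy') as [Hc Heq]. pose proof (Hiff _ Hc) as Hi.
      change (phi E (comp_part E X) (g y')) with (Phi (g y') (comp_Part Hsolid HX)) in Hi.
      now rewrite Heq in Hi. }
    exists (fun y' => W (y' (comp_Part Hsolid HX))). split; [|split].
    + exists (comp_Part Hsolid HX), W. auto.
    + now apply Hpre.
    + intros y' Hy'. now apply Hpre.
Qed.
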